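(* Let $C$ be a differential algebra over $\Lambda$ and $D$ a differential module over $C$ such that all $H_i(C)$ and $H_i(D)$ are free $\Lambda$-modules, and let $(H(C),\{X_i\})$ be the homology $A(\infty)$-algebra of $C$. Then there exist a structure of $A(\infty)$-module $(H(D),\{Y_i\})$, $Y_i:(\otimes^{i-1}H(C))\otimes H(D)\to H(D)$, $i=1,2,3,\dots$, over $(H(C),\{X_i\})$ on $H(D)$ such that $$Y_1=0,\qquad Y_2(a\otimes b)=-\hat a\cdot b$$ (where $\cdot$ is the induced action of $H(C)$ on $H(D)$), and a morphism $$(\{f_i\},\{g_i\}):\big((H(C),\{X_i\}),(H(D),\{Y_i\})\big)\to (C,D)$$ of the category $M(\infty)$ such that $f_1:H(C)\to C$ and $g_1:H(D)\to D$ induce the identity isomorphisms in homology.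
   Context: $\Lambda$ is an arbitrary associative ring with unit; modules and tensor products are over $\Lambda$. Differential modules and algebras are graded by non-negative integers, with differential $\partial$ of degree $-1$. A differential algebra is an associative graded algebra with $\partial(a\cdot b)=\partial a\cdot b+\hat a\cdot\partial b$ (a unit is not required); a differential module $D$ over $C$ is a left $C$-module with differential satisfying the same rule. For homogeneous $a$, $\hat a=(-1)^{\deg a}a$. Tensor products of homomorphisms are taken without extra signs. An $A(\infty)$-algebra $(M,\{m_i\})$ is a graded module $M$ with homomorphisms $m_i:\otimes^iM\to M$, $i\ge1$, such that $m_i((\otimes^iM)_q)\subset M_{q+i-2}$ and for all $i\ge1$ $$\sum_{k=0}^{i-1}\sum_{j=1}^{i-k}(-1)^k m_{i-j+1}(\hat a_1\otimes\cdots\otimes\hat a_k\otimes m_j(a_{k+1}\otimes\cdots\otimes a_{k+j})\otimes\cdots\otimes a_i)=0 .$$ A morphism $\{f_i\}:(M,\{m_i\})\to(M',\{m'_i\})$ is a set of homomorphisms $f_i:\otimes^iM\to M'$, $i\ge1$, with $f_i((\otimes^iM)_q)\subset M'_{q+i-1}$ and for all $i\ge1$ $$\sum_{k=0}^{i-1}\sum_{j=1}^{i-k}(-1)^k f_{i-j+1}(\hat a_1\otimes\cdots\otimes\hat a_k\otimes m_j(a_{k+1}\otimes\cdots\otimes a_{k+j})\otimes\cdots\otimes a_i)=\sum_{t=1}^{i}\sum_{S(t,i)}m'_t(f_{k_1}(a_1\otimes\cdots\otimes a_{k_1})\otimes\cdots\otimes f_{k_t}(a_{i-k_t+1}\otimes\cdots\otimes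 a_i)),$$ where $S(t,i)$ is the set of tuples of positive integers $(k_1,\dots,k_t)$ with $\sum k_p=i$. An $A(\infty)$-module $(P,\{p_i\})$ over $(M,\{m_i\})$ is a graded module $P$ with homomorphisms $p_i:(\otimes^{i-1}M)\otimes P\to P$, $i\ge1$, such that $p_i(((\otimes^{i-1}M)\otimes P)_q)\subset P_{q+i-2}$ and for all $i\ge1$ $$\sum_{k=0}^{i-2}\sum_{j=1}^{i-k-1}(-1)^k p_{i-j+1}(\hat a_1\otimes\cdots\otimes\hat a_k\otimes m_j(a_{k+1}\otimes\cdots\otimes a_{k+j})\otimes\cdots\otimes a_{i-1}\otimes b)+\sum_{k=0}^{i-1}(-1)^k p_{k+1}(\hat a_1\otimes\cdots\otimes\hat a_k\otimes p_{i-k}(a_{k+1}\otimes\cdots\otimes a_{i-1}\otimes b))=0 .$$ Objects of the category $M(\infty)$ are pairs $((M,\{m_i\}),(P,\{p_i\}))$ of an $A(\infty)$-algebra and an $A(\infty)$-module over it. A morphism to $((M',\{m'_i\}),(P',\{p'_i\}))$ is a pair $(\{f_i\},\{g_i\})$ where $\{f_i\}:(M,\{m_i\})\to(M',\{m_i'\})$ is a morphism of $A(\infty)$-algebras and $g_i:(\otimes^{i-1}M)\otimes P\to P'$, $i\ge1$, satisfy $g_i(((\otimes^{i-1}M)\otimes P)_q)\subset P'_{q+i-1}$ and for all $i\ge1$ $$\sum_{k=0}^{i-2}\sum_{j=1}^{i-k-1}(-1)^k g_{i-j+1}(\hat a_1\otimes\cdots\otimes\hat a_k\otimes m_j(a_{k+1}\otimes\cdots\otimes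 a_{k+j})\otimes\cdots\otimes a_{i-1}\otimes b)+\sum_{k=0}^{i-1}(-1)^k g_{k+1}(\hat a_1\otimes\cdots\otimes\hat a_k\otimes p_{i-k}(a_{k+1}\otimes\cdots\otimes a_{i-1}\otimes b))$$ $$=\sum_{t=1}^{i}\sum_{S(t,i)}p'_t(f_{k_1}(a_1\otimes\cdots\otimes a_{k_1})\otimes\cdots\otimes f_{k_{t-1}}(a_{k_1+\cdots+k_{t-2}+1}\otimes\cdots\otimes a_{k_1+\cdots+k_{t-1}})\otimes g_{k_t}(a_{i-k_t+1}\otimes\cdots\otimes a_{i-1}\otimes b)).$$ A differential algebra $(C,\partial,\cdot)$ is regarded as the $A(\infty)$-algebra with $m_1=\partial$, $m_2(a_1\otimes a_2)=-\hat a_1\cdot a_2$, $m_i=0$ for $i>2$; a differential module $D$ over $C$ is regarded as the $A(\infty)$-module with $p_1=\partial$, $p_2(a\otimes b)=-\hat a\cdot b$, $p_i=0$ for $i>2$. Thus $(C,D)$ is an object of $M(\infty)$. The homology $A(\infty)$-algebra of $C$ (with all $H_i(C)$ free) is an $A(\infty)$-algebra structure $(H(C),\{X_i\})$ with $X_1=0$, $X_2(a_1\otimes a_2)=-\hat a_1\cdot a_2$, for which there exists a morphism of $A(\infty)$-algebras $\{f_i\}:(H(C),\{X_i\})\to C$ with $f_1$ inducing the identity in homology. $H(C)$ and $H(D)$ carry zero differential when induced maps in homology are considered.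
   Formalization: The ground ring Λ is assumed commutative (the text says arbitrary associative with unit): over a noncommutative ring the tensor powers over Λ of Λ-modules are not defined, and reading modules as bimodules makes the claim false. *)

(* Defs.v *)
From HB Require Import structures.
From Stdlib Require List.
From mathcomp Require Import all_boot all_order all_algebra zify.
From mathcomp Require Import boolp classical_sets.
Set Implicit Arguments.
Unset Strict Implicit.
Unset Printing Implicit Defensive.
Import GRing.Theory.
Local Open Scope classical_set_scope.
Local Open Scope ring_scope.
Local Open Scope quotient_scope.

(* The ground ring is commutative: only then do modules over it have tensor
   products which are again modules over it.  The zero ring is allowed. *)

Section Graded.
Variable L : comPzRingType.

(* A graded module is presented by its total module together with the
   homogeneous parts M_q, q >= 0, of which it is the internal direct sum. *)
Record gmod := Gmod {
  gmod_sort :> lmodType L;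
  gpart : nat -> set gmod_sort;
  gpart0 : forall q, gpart q 0;
  gpartP : forall q (c : L) x y, gpart q x -> gpart q y -> gpart q (c *: x + y);
  gpart_span : forall x, exists nc : nat * (nat -> gmod_sort),
    (forall q, gpart q (nc.2 q)) /\ x = \sum_(q < nc.1) nc.2 q;
  gpart_direct : forall n (c : nat -> gmod_sort), (forall q, gpart q (c q)) ->
    \sum_(q < n) c q = 0 -> forall q, (q < n)%N -> c q = 0 }.

Definition gpartz (M : gmod) (z : int) : set M :=
  if z is Posz n then gpart n else [set 0].

Definition decomposition (M : gmod) (x : M) : nat * (nat -> M) :=
  sval (cid (gpart_span x)).

(* The sign operator, extended linearly from homogeneous elements; see
   [hat_homog], [hat_linear]. *)
Definition hat (M : gmod) (x : M) : M :=
  \sum_(q < (decomposition x).1) (-1) ^+ q *: (decomposition x).2 q.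

Section GradedTheory.
Variable M : gmod.
Implicit Types (x y : M) (c d : nat -> M).

Lemma gpartD q x y : gpart q x -> gpart q y -> gpart q (x + y).
Proof. by move=> hx hy; rewrite -[x]scale1r; apply: gpartP. Qed.

Lemma gpartZ q (a : L) x : gpart q x -> gpart q (a *: x).
Proof. by move=> hx; rewrite -[a *: x]addr0; apply: gpartP => //; apply: gpart0. Qed.

Lemma gpartB q x y : gpart q x -> gpart q y -> gpart q (x - y).
Proof. by move=> hx hy; rewrite addrC -scaleN1r; apply: gpartP. Qed.

Let trunc n c q : M := if (q < n)%N then c q else 0.

Let truncP n c : (forall q, gpart q (c q)) -> forall q, gpart q (trunc n c q).
Proof. by move=> hc q; rewrite /trunc; case: ifP => // _; apply: gpart0. Qed.

Let trunc_sum n N c (F : nat -> M -> M) : (n <= N)%N -> (forall q, F q 0 = 0) ->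
  \sum_(q < N) F q (trunc n c q) = \sum_(q < n) F q (c q).
Proof.
move=> le F0; rewrite (big_ord_widen N (fun q => F q (c q)) le).
rewrite [RHS]big_mkcond /=; apply: eq_bigr => q _.
by rewrite /trunc; case: ifP.
Qed.

Lemma decomposition_uniq n m c d (F : nat -> M -> M) :
  (forall q, gpart q (c q)) -> (forall q, gpart q (d q)) ->
  (forall q, F q 0 = 0) ->
  \sum_(q < n) c q = \sum_(q < m) d q ->
  \sum_(q < n) F q (c q) = \sum_(q < m) F q (d q).
Proof.
move=> hc hd F0 e; pose N := maxn n m.
rewrite -(trunc_sum c (leq_maxl n m) F0) -(trunc_sum d (leq_maxr n m) F0).
apply: eq_bigr => q _; congr F; apply/eqP; rewrite -subr_eq0; apply/eqP.
have h := @gpart_direct M N (fun q => trunc n c q - trunc m d q).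
apply: (h _ _ q (ltn_ord q)) => [r|].
  by apply: gpartB; apply: truncP.
rewrite sumrB (trunc_sum c (F := fun _ => id) (leq_maxl n m)) //.
by rewrite (trunc_sum d (F := fun _ => id) (leq_maxr n m)) // e subrr.
Qed.

Lemma hat_sum n c : (forall q, gpart q (c q)) ->
  hat (\sum_(q < n) c q) = \sum_(q < n) (-1) ^+ q *: c q.
Proof.
move=> hc; rewrite /hat /decomposition; case: cid => -[m d] /= [hd e].
by apply: (@decomposition_uniq _ _ _ _ (fun q x => (-1) ^+ q *: x)) => //;
  move=> q; rewrite scaler0.
Qed.

Lemma hat_homog q x : gpart q x -> hat x = (-1) ^+ q *: x.
Proof.
move=> hx; pose c r : M := if r == q then x else 0.
have hc r : gpart r (c r) by rewrite /c; case: eqP => [->|_] //; apply: gpart0.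
have e (F : nat -> M -> M) : (forall q, F q 0 = 0) ->
    \sum_(r < q.+1) F r (c r) = F q x.
  move=> F0; rewrite big_ord_recr /= big1 ?add0r /c ?eqxx // => i _.
  by rewrite ltn_eqF.
have := hat_sum q.+1 hc; rewrite (e (fun _ => id)) //.
by rewrite (e (fun q x => (-1) ^+ q *: x)) // => r; rewrite scaler0.
Qed.

Lemma hat_linear : linear (@hat M).
Proof.
move=> a x y.
have [[n c] /= [hc ex]] := gpart_span x; have [[m d] /= [hd ey]] := gpart_span y.
pose N := maxn n m.
have hx := trunc_sum c (F := fun _ => id) (leq_maxl n m) (fun=> erefl).
have hy := trunc_sum d (F := fun _ => id) (leq_maxr n m) (fun=> erefl).
rewrite {}ex {}ey -hx -hy scaler_sumr -big_split /=.
rewrite (hat_sum N (c := fun q => a *: trunc n c q + trunc m d q)); last first.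
  by move=> q; apply: gpartP; apply: truncP.
rewrite !hat_sum; try exact: truncP.
rewrite scaler_sumr -big_split /=; apply: eq_bigr => q _.
by rewrite scalerDr !scalerA mulrC.
Qed.

HB.instance Definition _ := GRing.isLinear.Build L M M *:%R (@hat M) hat_linear.

Lemma hatK : involutive (@hat M).
Proof.
move=> x; have [[n c] /= [hc ->]] := gpart_span x.
rewrite hat_sum // (hat_sum n (c := fun q => (-1) ^+ q *: c q)) => [|q].
  by apply: eq_bigr => q _; rewrite scalerA -expr2 sqrr_sign scale1r.
by apply: gpartZ.
Qed.

End GradedTheory.

Section Free.
Variable V : lmodType L.

Definition is_basis_of (P B : set V) : Prop :=
  [/\ B `<=` P,
      forall v, P v -> exists (s : seq V) (c : V -> L),
        (forall x, x \in s -> B x) /\ v = \sum_(x <- s) c x *: x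
    & forall (s : seq V) (c : V -> L), uniq s -> (forall x, x \in s -> B x) ->
        \sum_(x <- s) c x *: x = 0 -> forall x, x \in s -> c x = 0].

Definition is_free (P : set V) : Prop := exists B, is_basis_of P B.

End Free.

Record dgmod := Dgmod {
  dg_gmod :> gmod;
  diff : dg_gmod -> dg_gmod;
  diff_linear : linear diff;
  diff_deg : forall q x, gpart q x -> gpartz (q%:Z - 1) (diff x);
  diffK : forall x, diff (diff x) = 0 }.

HB.instance Definition _ (D : dgmod) :=
  GRing.isLinear.Build L D D *:%R (@diff D) (@diff_linear D).

Lemma diff_gpartS (D : dgmod) q (x : D) : gpart q.+1 x -> gpart q (diff x).
Proof. by move/diff_deg; rewrite -addn1 PoszD addrK. Qed.

Lemma diff_gpart0 (D : dgmod) (x : D) : gpart 0 x -> diff x = 0.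
Proof. by move/diff_deg. Qed.

Lemma diff_hat (D : dgmod) (x : D) : diff (hat x) = - hat (diff x).
Proof.
have [[n c] /= [hc ->]] := gpart_span x.
rewrite !(linear_sum (@hat D)) !(linear_sum (@diff D)) (linear_sum (@hat D)).
rewrite -sumrN; apply: eq_bigr => -[q ltq] _ /=.
rewrite (hat_homog (hc q)) (linearZ_LR (@diff D)) /=.
case: q {ltq} => [|q]; first by rewrite (diff_gpart0 (hc _)) !linear0.
by rewrite (hat_homog (diff_gpartS (hc _))) exprS mulN1r scaleNr.
Qed.

Section Homology.
Variable D : dgmod.

Definition is_cycle : {pred D} := [pred x | diff x == 0].

Fact is_cycle_submod : submod_closed is_cycle.
Proof.
split; first by rewrite inE linear0.
by move=> a x y; rewrite !inE linearP /= => /eqP-> /eqP->; rewrite scaler0 addr0.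
Qed.
HB.instance Definition _ := GRing.isSubmodClosed.Build L D is_cycle is_cycle_submod.

Record cycle := Cycle { cycle_val :> D; _ : cycle_val \in is_cycle }.
HB.instance Definition _ := [isSub for cycle_val].
HB.instance Definition _ := [Choice of cycle by <:].
HB.instance Definition _ := [SubChoice_isSubLmodule of cycle by <:].

Lemma diff_cycle (z : cycle) : diff (z : D) = 0.
Proof. by case: z => x /= /eqP. Qed.

Definition is_boundary : {pred cycle} :=
  [pred z : cycle | `[< exists y : D, diff y = z >]].

Lemma is_boundaryP (z : cycle) :
  reflect (exists y : D, diff y = z) (z \in is_boundary).
Proof. exact: asboolP. Qed.

Fact is_boundary_submod : submod_closed is_boundary.
Proof.
split; first by apply/is_boundaryP; exists 0; rewrite linear0.
move=> a x y /is_boundaryP[x' ex] /is_boundaryP[y' ey].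
by apply/is_boundaryP; exists (a *: x' + y'); rewrite linearP /= ex ey.
Qed.
HB.instance Definition _ :=
  GRing.isSubmodClosed.Build L cycle is_boundary is_boundary_submod.

Definition homology_sort := Quotient.quot is_boundary.
HB.instance Definition _ := GRing.Zmodule.on homology_sort.

Definition hclass (z : cycle) : homology_sort := \pi z.

Lemma hclass_eq (z w : cycle) :
  hclass z = hclass w <-> exists y : D, diff y = (z : D) - (w : D).
Proof.
have e := Quotient.idealrBE is_boundary z w.
split=> [h|/(is_boundaryP (z - w)) h]; last by apply/eqP; rewrite -e.
by apply/(is_boundaryP (z - w)); rewrite e; apply/eqP.
Qed.

Lemma hclass_repr (h : homology_sort) : hclass (repr h) = h.
Proof. exact: reprK. Qed.

Lemma hclassD (z w : cycle) : hclass (z + w) = hclass z + hclass w.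
Proof. by rewrite /hclass raddfD. Qed.

Definition hscale (a : L) (h : homology_sort) : homology_sort :=
  hclass (a *: repr h).

Lemma hscaleE a (z : cycle) : hscale a (hclass z) = hclass (a *: z).
Proof.
apply/hclass_eq; have /hclass_eq[y ey] := hclass_repr (hclass z).
by exists (a *: y); rewrite linearZ /= ey scalerBr.
Qed.

Fact hscaleA a b h : hscale a (hscale b h) = hscale (a * b) h.
Proof. by rewrite -(hclass_repr h) !hscaleE scalerA. Qed.
Fact hscale1 : left_id 1 hscale.
Proof. by move=> h; rewrite -(hclass_repr h) hscaleE scale1r. Qed.
Fact hscaleDr : right_distributive hscale +%R.
Proof.
move=> a h k; rewrite -(hclass_repr h) -(hclass_repr k).
by rewrite -hclassD !hscaleE scalerDr hclassD.
Qed.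
Fact hscaleDl h : {morph hscale^~ h : a b / a + b}.
Proof.
move=> a b /=; rewrite -(hclass_repr h).
by rewrite !hscaleE scalerDl hclassD.
Qed.
HB.instance Definition _ := GRing.Zmodule_isLmodule.Build L homology_sort
  hscaleA hscale1 hscaleDr hscaleDl.

Lemma hclass_linear : linear hclass.
Proof. by move=> a z w; rewrite hclassD -hscaleE. Qed.
HB.instance Definition _ :=
  GRing.isLinear.Build L cycle homology_sort *:%R hclass hclass_linear.

Lemma hclass0P (z : cycle) : hclass z = 0 <-> exists y : D, diff y = z.
Proof. by rewrite -(linear0 hclass) hclass_eq subr0. Qed.

Definition homology_part q : set homology_sort :=
  [set h | exists2 z : cycle, gpart q (z : D) & hclass z = h].

Fact homology_part0 q : homology_part q 0.
Proof. by exists 0; rewrite ?linear0 //; apply: gpart0. Qed.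

Fact homology_partP q (c : L) x y :
  homology_part q x -> homology_part q y -> homology_part q (c *: x + y).
Proof.
move=> [z hz <-] [w hw <-]; exists (c *: z + w); last by rewrite linearP.
exact: gpartP.
Qed.

Lemma val_sum n (z : nat -> cycle) :
  (\sum_(q < n) z q : cycle) = \sum_(q < n) (z q : D) :> D.
Proof. exact: (raddf_sum val). Qed.

Lemma cycle_component n (c : nat -> D) : (forall q, gpart q (c q)) ->
  diff (\sum_(q < n) c q) = 0 -> forall q, (q < n)%N -> diff (c q) = 0.
Proof.
case: n => // n hc; rewrite linear_sum big_ord_recl /= diff_gpart0 // add0r.
move=> e [|q] ltq; first exact: diff_gpart0.
exact: (@gpart_direct D n (fun q => diff (c q.+1))
  (fun q => diff_gpartS (hc q.+1))).
Qed.

Fact homology_part_span h : exists nc : nat * (nat -> homology_sort),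
  (forall q, homology_part q (nc.2 q)) /\ h = \sum_(q < nc.1) nc.2 q.
Proof.
have [[n c] /= [hc e]] := gpart_span (repr h : D).
have hz q : (if (q < n)%N then c q else 0) \in is_cycle.
  case: ifP => [ltq|_]; last exact: rpred0.
  apply/eqP; apply: (cycle_component hc _ ltq).
  by rewrite -e diff_cycle.
exists (n, fun q => hclass (Cycle (hz q))); split=> /= [q|].
  exists (Cycle (hz q)) => //=; case: ifP => // _; exact: gpart0.
rewrite -(hclass_repr h) -(linear_sum hclass); congr hclass; apply: val_inj.
apply: etrans e (etrans _ (esym (val_sum n (fun q => Cycle (hz q))))).
apply: eq_bigr => q _; transitivity (if (q < n)%N then c q else 0) => //.
by rewrite ltn_ord.
Qed.

Fact homology_part_direct n (c : nat -> homology_sort) :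
  (forall q, homology_part q (c q)) -> \sum_(q < n) c q = 0 ->
  forall q, (q < n)%N -> c q = 0.
Proof.
move=> hc; pose z q := s2val (cid2 (hc q)).
have hz q : gpart q (z q : D) := s2valP (cid2 (hc q)).
have ez q : hclass (z q) = c q := s2valP' (cid2 (hc q)).
rewrite (eq_bigr (fun q : 'I_n => hclass (z q))) => [|q _]; last by rewrite ez.
rewrite -(linear_sum hclass) => /hclass0P[y]; rewrite val_sum.
have [[m d] /= [hd ->]] := gpart_span y; rewrite linear_sum => e q ltq.
rewrite -ez; apply/hclass0P; pose d' r := if (r < m)%N then d r else 0.
have hd' r : gpart r (d' r) by rewrite /d'; case: ifP => // _; apply: gpart0.
exists (d' q.+1); apply/eqP; rewrite -subr_eq0; apply/eqP.
pose E (r : nat) (x : D) := if r == q then x else 0.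
have E0 r : E r 0 = 0 by rewrite /E; case: ifP.
have es : \sum_(r < m) diff (d' r.+1) = \sum_(r < n) (z r : D).
  rewrite -e; case: m @d' hd' {e} => [|m] d' hd'; first by rewrite !big_ord0.
  rewrite big_ord_recr /= {2}/d' ltnn linear0 addr0.
  rewrite [RHS]big_ord_recl /= diff_gpart0 // add0r.
  by apply: eq_bigr => r _; rewrite /d' ltnS ltn_ord.
have := decomposition_uniq (F := E) (fun r => diff_gpartS (hd' r.+1)) hz E0 es.
rewrite /E -!big_mkcond /= (big_ord1_eq _ (fun r => (z r : D))).
rewrite (big_ord1_eq _ (fun r => diff (d' r.+1))) ltq.
case: ifP => [_ ->|]; first by rewrite subrr.
move=> /negbT; rewrite -leqNgt => lemq <-; rewrite subr0.
by rewrite /d' ltnNge (leq_trans lemq) //= linear0.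
Qed.

(* Homology as a graded module: cycles modulo boundaries, H_q being the
   classes of the cycles of degree q. *)
Definition homology : gmod := Gmod homology_part0 homology_partP
  homology_part_span homology_part_direct.

(* [f1], a map from homology with zero differential, takes values in cycles
   and the class of [f1 h] is [h]. *)
Definition induces_id (f1 : homology -> D) : Prop :=
  forall h, exists2 z : cycle, z = f1 h :> D & hclass z = h.

End Homology.

Record dg_pairing (D E F : dgmod) (op : D -> E -> F) : Prop := DgPairing {
  pairing_linearl : forall b, linear (op^~ b);
  pairing_linearr : forall a, linear (op a);
  pairing_deg : forall q r a b,
    gpart q a -> gpart r b -> gpart (q + r)%N (op a b);
  pairing_leibniz : forall a b,
    diff (op a b) = op (diff a) b + op (hat a) (diff b) }.

Section InducedPairing.
Variables (D E F : dgmod) (op : D -> E -> F) (hop : dg_pairing op).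

Lemma pairing0l b : op 0 b = 0.
Proof.
have /= := pairing_linearl hop b (-1) 0 0.
by rewrite !scaleN1r !addNr.
Qed.

Lemma pairing0r a : op a 0 = 0.
Proof.
have /= := pairing_linearr hop a (-1) 0 0.
by rewrite !scaleN1r !addNr.
Qed.

Lemma pairingBl a a' b : op (a - a') b = op a b - op a' b.
Proof.
have /= := pairing_linearl hop b (-1) a' a.
by rewrite !scaleN1r [- a' + a]addrC [- op a' b + _]addrC.
Qed.

Lemma pairingBr a b b' : op a (b - b') = op a b - op a b'.
Proof.
have /= := pairing_linearr hop a (-1) b' b.
by rewrite !scaleN1r [- b' + b]addrC [- op a b' + _]addrC.
Qed.

Fact pairing_cycle (z : cycle D) (w : cycle E) : op z w \in @is_cycle F.
Proof.
by rewrite inE (pairing_leibniz hop) !diff_cycle pairing0l pairing0r addr0.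
Qed.

(* The pairing induced in homology, computed on representatives; see
   [hpairingE]. *)
Definition hpairing (x : homology D) (y : homology E) : homology F :=
  hclass (Cycle (pairing_cycle (repr (x : homology_sort D))
                               (repr (y : homology_sort E)))).

Lemma hpairingE (z : cycle D) (w : cycle E) :
  hpairing (hclass z) (hclass w) = hclass (Cycle (pairing_cycle z w)).
Proof.
apply/hclass_eq => /=.
set z' := repr _; set w' := repr _.
have /hclass_eq[x ex] : hclass z' = hclass z by apply: hclass_repr.
have /hclass_eq[y ey] : hclass w' = hclass w by apply: hclass_repr.
exists (op x w' + op (hat (z : D)) y); rewrite linearD /= !(pairing_leibniz hop).
rewrite diff_hat !diff_cycle !linear0 pairing0l pairing0r addr0 add0r hatK ex ey.
by rewrite pairingBl pairingBr addrA subrK.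
Qed.

End InducedPairing.

(* Not necessarily unital. *)
Record dgalg := Dgalg {
  dga_mod :> dgmod;
  dga_mul : dga_mod -> dga_mod -> dga_mod;
  dga_pairing : dg_pairing dga_mul;
  dga_mulA : associative dga_mul }.

Record dgamod (C : dgalg) := Dgamod {
  dgm_mod :> dgmod;
  dgm_act : C -> dgm_mod -> dgm_mod;
  dgm_pairing : dg_pairing dgm_act;
  dgm_actA : forall a b x, dgm_act a (dgm_act b x) = dgm_act (dga_mul a b) x }.

Definition hmul (C : dgalg) : homology C -> homology C -> homology C :=
  hpairing (dga_pairing C).

Definition hact (C : dgalg) (D : dgamod C) :
    homology C -> homology D -> homology D :=
  hpairing (dgm_pairing D).

(* Homomorphisms out of tensor powers are multilinear maps.  A sequence
   (m_i), i >= 1, of homomorphisms M^{(x)i} -> N is one function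
   [m : seq M -> N], with m_i its restriction to lists of length i; its value
   on the empty list plays no role.  A sequence of homomorphisms
   p_i : M^{(x)(i-1)} (x) P -> Q is one function [p : seq M -> P -> Q], with
   p_i its restriction to lists of length i - 1. *)
Definition multilinear (V W : lmodType L) (f : seq V -> W) : Prop :=
  forall s1 s2, linear (fun x => f (s1 ++ x :: s2)).

Definition multilinear2 (V P Q : lmodType L) (g : seq V -> P -> Q) : Prop :=
  (forall b, multilinear (g^~ b)) /\ (forall s, linear (g s)).

(* [a] is a list of homogeneous elements of degrees [q]. *)
Definition homogeneous (M : gmod) (q : seq nat) (a : seq M) : Prop :=
  List.Forall2 (@gpart M) q a.

(* The i-th map raises degrees by i + d. *)
Definition has_degree (M N : gmod) (d : int) (f : seq M -> N) : Prop :=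
  forall q a, (0 < size a)%N -> homogeneous q a ->
    gpartz ((sumn q)%:Z + (size a)%:Z + d) (f a).

Definition has_degree2 (M P Q : gmod) (d : int) (g : seq M -> P -> Q) : Prop :=
  forall q r a b, homogeneous q a -> gpart r b ->
    gpartz ((sumn q + r)%N%:Z + (size a).+1%:Z + d) (g a b).

(* sum_{k,j} (-1)^k f(^a_1, .., ^a_k, m_j(a_{k+1}, .., a_{k+j}), .., a_n) *)
Definition insert_sum (M : gmod) (N : lmodType L) (f : seq M -> N)
    (m : seq M -> M) (a : seq M) : N :=
  \sum_(0 <= k < size a) \sum_(1 <= j < (size a - k).+1)
    (-1) ^+ k *: f ([seq hat x | x <- take k a]
                    ++ m (take j (drop k a)) :: drop (k + j) a).

(* sum_k (-1)^k g(^a_1, .., ^a_k, p(a_{k+1}, .., a_n, b)) *)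
Definition insert_last_sum (M P : gmod) (Q : lmodType L) (g : seq M -> P -> Q)
    (p : seq M -> P -> P) (a : seq M) (b : P) : Q :=
  \sum_(0 <= k < (size a).+1)
    (-1) ^+ k *: g [seq hat x | x <- take k a] (p (drop k a) b).

(* S(t, i); the entries of such a tuple cannot exceed i. *)
Definition compositions (t i : nat) : {pred t.-tuple 'I_i.+1} :=
  [pred ks : t.-tuple 'I_i.+1 |
    all (fun k => 0 < k)%N [seq val k | k <- ks]
    && (sumn [seq val k | k <- ks] == i)].
Arguments compositions : clear implicits.

Definition split_sum (M M' : gmod) (f : seq M -> M') (m' : seq M' -> M')
    (a : seq M) : M' :=
  \sum_(1 <= t < (size a).+1) \sum_(ks in compositions t (size a))
    m' [seq f s | s <- reshape [seq val k | k <- ks] a].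

(* Here i = (size a).+1, so [reshape] cuts [a] into t blocks, the last of which
   is truncated to k_t - 1 elements and goes to [g] together with [b]. *)
Definition split_last_sum (M M' P P' : gmod) (f : seq M -> M')
    (g : seq M -> P -> P') (p' : seq M' -> P' -> P') (a : seq M) (b : P) : P' :=
  \sum_(1 <= t < (size a).+2) \sum_(ks in compositions t (size a).+1)
    let blocks := reshape [seq val k | k <- ks] a in
    p' [seq f s | s <- take t.-1 blocks] (g (nth [::] blocks t.-1) b).

Definition ainf_algebra (M : gmod) (m : seq M -> M) : Prop :=
  [/\ multilinear m, has_degree (-2) m
    & forall a, (0 < size a)%N -> insert_sum m m a = 0].

Definition ainf_morphism (M M' : gmod) (m : seq M -> M) (m' : seq M' -> M')
    (f : seq M -> M') : Prop :=
  [/\ multilinear f, has_degree (-1) f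
    & forall a, (0 < size a)%N -> insert_sum f m a = split_sum f m' a].

Definition ainf_module (M P : gmod) (m : seq M -> M) (p : seq M -> P -> P) :
    Prop :=
  [/\ multilinear2 p, has_degree2 (-2) p
    & forall a b, insert_sum (p^~ b) m a + insert_last_sum p p a b = 0].

Definition Minf_object (M P : gmod) (m : seq M -> M) (p : seq M -> P -> P) :
    Prop :=
  ainf_algebra m /\ ainf_module m p.

Definition Minf_morphism (M P M' P' : gmod)
    (m : seq M -> M) (p : seq M -> P -> P)
    (m' : seq M' -> M') (p' : seq M' -> P' -> P')
    (f : seq M -> M') (g : seq M -> P -> P') : Prop :=
  [/\ ainf_morphism m m' f, multilinear2 g, has_degree2 (-1) g
    & forall a b, insert_sum (g^~ b) m a + insert_last_sum g p a b
                  = split_last_sum f g p' a b].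

Definition dga_ainf (C : dgalg) (s : seq C) : C :=
  match s with
  | [:: a] => diff a
  | [:: a1; a2] => - dga_mul (hat a1) a2
  | _ => 0
  end.

Definition dgm_ainf (C : dgalg) (D : dgamod C) (s : seq C) (b : D) : D :=
  match s with
  | [::] => diff b
  | [:: a] => - dgm_act (hat a) b
  | _ => 0
  end.

Lemma pairingDl (D E F : dgmod) (op : D -> E -> F) (h : dg_pairing op) a a' b : op (a + a') b = op a b + op a' b.
Proof. by rewrite -[in LHS](opprK a') (pairingBl h) -[- a']add0r (pairingBl h) (pairing0l h) add0r opprK. Qed.
Lemma pairingNl (D E F : dgmod) (op : D -> E -> F) (h : dg_pairing op) a b : op (- a) b = - op a b.
Proof. by rewrite -[- a]add0r (pairingBl h) (pairing0l h) add0r. Qed.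
Lemma pairingNr (D E F : dgmod) (op : D -> E -> F) (h : dg_pairing op) a b : op a (- b) = - op a b.
Proof. by rewrite -[- b]add0r (pairingBr h) (pairing0r h) add0r. Qed.
Lemma diffN (D : dgmod) (x : D) : diff (- x) = - diff x.
Proof. exact: (linearN (@diff D)). Qed.
Lemma hatN (D : gmod) (x : D) : hat (- x) = - hat x.
Proof. exact: (linearN (@hat D)). Qed.
Lemma gpartN (M : gmod) q (x : M) : gpart q x -> gpart q (- x).
Proof. by move=> h; rewrite -scaleN1r; apply: gpartZ. Qed.

Lemma hat_op (D E F : dgmod) (op : D -> E -> F) (h : dg_pairing op) a b :
  hat (op a b) = op (hat a) (hat b).
Proof.
have opZl c x y : op (c *: x) y = c *: op x y.
  have /= := pairing_linearl h y c x 0; rewrite !addr0 => ->.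
  by rewrite (pairing0l h) addr0.
have opZr c x y : op x (c *: y) = c *: op x y.
  have /= := pairing_linearr h x c y 0; rewrite !addr0 => ->.
  by rewrite (pairing0r h) addr0.
have opsl n (c : nat -> D) y : op (\sum_(i < n) c i) y = \sum_(i < n) op (c i) y.
  elim: n => [|n IH]; first by rewrite !big_ord0 (pairing0l h).
  by rewrite !big_ord_recr /= (pairingDl h) IH.
have opsr n (c : nat -> E) x : op x (\sum_(i < n) c i) = \sum_(i < n) op x (c i).
  elim: n => [|n IH]; first by rewrite !big_ord0 (pairing0r h).
  rewrite !big_ord_recr /= -IH.
  by have /= := pairing_linearr h x 1 (\sum_(i < n) c i) (c n); rewrite !scale1r.
have [[n c] /= [hc ->]] := gpart_span a; have [[m d] /= [hd ->]] := gpart_span b.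
rewrite opsl !(linear_sum (@hat _)) /= .
rewrite (eq_bigr (fun i : 'I_n => (-1) ^+ i *: c i)); last by move=> i _; rewrite (hat_homog (hc i)).
rewrite (opsl n (fun i => (-1) ^+ i *: c i)).
apply: eq_bigr => i _.
rewrite opsr (linear_sum (@hat _)) /=.
rewrite (opsr m (fun j => hat (d j))).
apply: eq_bigr => j _.
rewrite (hat_homog (pairing_deg h (hc i) (hd j))) (hat_homog (hd j)) opZl opZr scalerA exprD.
by [].
Qed.

Lemma dga_ainf_algebra (C : dgalg) : ainf_algebra (@dga_ainf C).
Proof.
have P := dga_pairing C.
split.
- move=> s1 s2 a x y.
  case: s1 s2 => [|u [|v s1]] [|w [|z s2]] //=; rewrite ?scaler0 ?addr0 //.
  + exact: diff_linear.
  + by rewrite (hat_linear a x y) (pairing_linearl P) opprD scalerN.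
  + by rewrite (pairing_linearr P) opprD scalerN.
  + by case: s1 => [|? ?] /=; rewrite scaler0 addr0.
  + by case: s1 => [|? ?] /=; rewrite scaler0 addr0.
  + by case: s1 => [|? ?] /=; rewrite scaler0 addr0.
- move=> q a _ H.
  case: H => [|q1 a1 qs s h1 [|q2 a2 qs' s' h2 [|q3 a3 qs'' s'' h3 _]]] /=.
  + by [].
  + rewrite addn0; have := diff_deg h1; congr gpartz; lia.
  + have -> : (q1 + (q2 + 0))%N%:Z + 2%:Z - 2%:Z = (q1 + q2)%N%:Z by lia.
    apply: gpartN; apply: (pairing_deg P) => //.
    by rewrite (hat_homog h1); apply: gpartZ.
  + set z := _ + _; have : 0 <= z by rewrite /z; lia.
    by case: z => // n _; apply: gpart0.
- case=> // a1 [|a2 [|a3 [|a4 s]]] _.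
  + rewrite /insert_sum /= !big_nat1 /= scale1r; exact: diffK.
  + rewrite /insert_sum unlock /= !addr0.
    rewrite !expr0 ?expr1 !scale1r scaleN1r diffN (pairing_leibniz P) diff_hat.
    rewrite !(pairingNl P) hatK opprD !opprK.
    by rewrite addrA addNr add0r addNr.
  + rewrite /insert_sum unlock /= ?addr0.
    rewrite !expr0 expr1 !scale1r !scaleN1r ?oppr0 ?scaler0 (linear0 (@diff _)) ?addr0 ?add0r.
    rewrite !(pairingNl P, pairingNr P) ?opprK hatN (pairingNl P) opprK (hat_op P) hatK dga_mulA ?add0r ?addr0.
    by rewrite (subrr, addNr).
  + have : (3 < size [:: a1, a2, a3, a4 & s])%N by [].
    move: [:: a1, a2, a3, a4 & s] => w hw.
    rewrite /insert_sum big_nat big1 // => k /andP[_ ltk].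
    rewrite big_nat big1 // => j /andP[j1 ltj].
    have [lej|gtj] := leqP j 2.
      set t := _ ++ _; have : (2 < size t)%N.
        rewrite /t size_cat /= size_map !size_take !size_drop; move: hw ltk ltj; case: ifP; lia.
      by case: t => [|? [|? [|? ?]]] //; rewrite scaler0.
    set t := take j _; have : (2 < size t)%N.
        rewrite /t size_take size_drop; case: ifP; move: hw ltk ltj; lia.
    case: t => [|? [|? [|? ?]]] //= _.
    move: (map _ _) => u; case: u => [|x [|y t]] /=; last by rewrite ?scaler0; case: t => *; rewrite ?scaler0.
      by case: drop => [|? [|? ?]]; rewrite ?(linear0 (@diff _)) ?(linear0 (@hat _)) ?(pairing0l P) ?oppr0 ?scaler0.
    by case: drop => [|? ?]; rewrite ?(pairing0r P) ?oppr0 ?scaler0.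
Qed.

Lemma dgm_ainf_module (C : dgalg) (D : dgamod C) : ainf_module (@dga_ainf C) (@dgm_ainf C D).
Proof.
have P := dgm_pairing D.
split.
- split.
  + move=> b s1 s2 a x y; case: s1 s2 => [|u [|v s1]] [|w s2] //=; rewrite ?scaler0 ?addr0 //.
    by rewrite (hat_linear a x y) (pairing_linearl P) opprD scalerN.
  + move=> [|u [|v s]] a x y /=; rewrite ?scaler0 ?addr0 //.
    exact: diff_linear.
    by rewrite (pairing_linearr P) opprD scalerN.
- move=> q r a b H hb.
  case: H => [|q1 a1 qs s h1 [|q2 a2 qs' s' h2 H]] /=.
  + rewrite add0n; have := diff_deg hb; congr gpartz; lia.
  + have -> : (q1 + 0 + r)%N%:Z + 2%:Z - 2%:Z = (q1 + r)%N%:Z by lia.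
    apply: gpartN; apply: (pairing_deg P) => //.
    by rewrite (hat_homog h1); apply: gpartZ.
  + set z := _ + _; have : 0 <= z by rewrite /z; lia.
    by case: z => // n _; apply: gpart0.
- move=> [|a1 [|a2 [|a3 s]]] b.
  + rewrite /insert_sum /insert_last_sum unlock /= add0r addr0 scale1r; exact: diffK.
  + rewrite /insert_sum /insert_last_sum unlock /= ?addr0.
    rewrite !expr0 expr1 !scale1r scaleN1r diffN (pairing_leibniz P) diff_hat.
    rewrite !(pairingNl P) hatK opprK opprD opprK.
    by rewrite addrNK addNr.
  + rewrite /insert_sum /insert_last_sum unlock /= ?addr0.
    rewrite !expr0 ?expr1 !scale1r !scaleN1r ?oppr0 ?scaler0 (linear0 (@diff _)) ?addr0 ?add0r.
    by rewrite hatN (pairingNl P) (hat_op (dga_pairing C)) hatK (pairingNr P) !opprK dgm_actA subrr.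
  + have : (2 < size [:: a1, a2, a3 & s])%N by [].
    move: [:: a1, a2, a3 & s] => w hw.
    rewrite /insert_sum /insert_last_sum [X in X + _]big_nat [X in _ + X]big_nat !big1 ?addr0 //.
      move=> k /andP[_ ltk].
      have [k1|k1] := leqP k 1.
        have : (1 < size (drop k w))%N by rewrite size_drop; lia.
        case: drop => [|? [|? ?]] //= _.
        by case: map => [|? [|? ?]] /=; rewrite ?(linear0 (@diff _)) ?(pairing0r P) ?oppr0 ?scaler0.
      have : (1 < size (map (@hat C) (take k w)))%N.
        by rewrite size_map size_take; case: ifP; lia.
      by case: map => [|? [|? ?]] //=; rewrite scaler0.
    move=> k /andP[_ ltk].
    rewrite big_nat big1 // => j /andP[j1 ltj].
    have [lej|gtj] := leqP j 2.
      set t := _ ++ _; have : (1 < size t)%N.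
        rewrite /t size_cat /= size_map !size_take !size_drop; move: hw ltk ltj; case: ifP; lia.
      by case: t => [|? [|? ?]] //; rewrite scaler0.
    set t := take j _; have : (2 < size t)%N.
        rewrite /t size_take size_drop; case: ifP; move: hw ltk ltj; lia.
    case: t => [|? [|? [|? ?]]] //= _.
    move: (map _ _) => u; case: u => [|x t] /=; last by rewrite ?scaler0; case: t => *; rewrite ?scaler0.
    by case: drop => [|? ?]; rewrite ?(linear0 (@hat _)) ?(pairing0l P) ?oppr0 ?scaler0.
Qed.
Lemma dg_Minf_object (C : dgalg) (D : dgamod C) :
  Minf_object (@dga_ainf C) (@dgm_ainf C D).
Proof. by split; [apply: dga_ainf_algebra | apply: dgm_ainf_module]. Qed.

Definition homology_ainf_algebra (C : dgalg)
    (X : seq (homology C) -> homology C) : Prop :=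
  [/\ ainf_algebra X,
      forall a, X [:: a] = 0,
      forall a1 a2, X [:: a1; a2] = - hmul (hat a1) a2
    & exists f : seq (homology C) -> C,
        ainf_morphism X (@dga_ainf C) f /\ induces_id (fun h => f [:: h])].

End Graded.

(* Main.v *)
Require Import Defs.
From mathcomp Require Import all_boot all_order all_algebra zify.
From mathcomp Require Import boolp classical_sets.
Set Implicit Arguments.
Unset Strict Implicit.
Unset Printing Implicit Defensive.
Import GRing.Theory.
Local Open Scope ring_scope.

(** In terms of the suspension sign [shat x = - hat x] every sign [(-1)^k]
    disappears: structure maps anticommute and morphisms commute with [shat].
    Let [dom phi] be the composite of a multilinear [phi : seq M -> P -> D] with
    the differential of the bar construction, and let [E phi] ([defect]) be the
    difference of the two sides of the equation of a morphism of [M(oo)].  Then,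
    for any operations [Y],
      [diff (E g a b) + sum f u . E g v b + dom (E g) a b
         = sum g u (A v b)],
    the sums being over [a = u ++ v] and [A] being the left-hand side of the
    relations of an A(oo)-module for [Y].
    Suppose that [E g] and [A] vanish on lists shorter than [n].  As the unary
    operations on homology are zero, the identity on lists of length [n] is
    [diff U = g_1 A] with [U := E g], whence [A = 0] and [U] is a cycle.
    Subtracting the class of [U] from [Y] makes [U + g_1 Y] a boundary, and a
    multilinear homogeneous preimage, which exists because the homology is
    free, corrects [g] so that [E g] vanishes on lists of length [n]. *)

Section LinearPredicate.
Variables (L : pzRingType) (V W : lmodType L) (h : V -> W).
Hypothesis lin : linear h.

Lemma lin0 : h 0 = 0.
Proof. by have := lin (-1) 0 0; rewrite !scaleN1r !addNr. Qed.

Lemma linD x y : h (x + y) = h x + h y.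
Proof. by have := lin 1 x y; rewrite !scale1r. Qed.

Lemma linZ c x : h (c *: x) = c *: h x.
Proof. by have := lin c x 0; rewrite lin0 !addr0. Qed.

Lemma linN x : h (- x) = - h x.
Proof. by rewrite -!scaleN1r linZ. Qed.

Lemma linB x y : h (x - y) = h x - h y.
Proof. by rewrite linD linN. Qed.

End LinearPredicate.

(** * Multilinear maps on lists and sums over splittings *)

Section Splits.
Variable T : Type.

Fixpoint splits (W : nmodType) (a : seq T) (F : seq T -> seq T -> W) : W :=
  if a is x :: a' then F [::] a + splits a' (fun u v => F (x :: u) v)
  else F [::] [::].

Definition splits1 (W : nmodType) (a : seq T) (F : seq T -> seq T -> W) : W :=
  if a is x :: a' then splits a' (fun u v => F (x :: u) v) else 0.

Lemma eq_splits (W : nmodType) a (F G : seq T -> seq T -> W) :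
  (forall u v, a = u ++ v -> F u v = G u v) -> splits a F = splits a G.
Proof.
elim: a F G => [|x a IH] F G e /=; first exact: e.
by rewrite (e [::] (x :: a)) //; congr (_ + _); apply: IH => u v ea; apply: e; rewrite ea.
Qed.

Lemma eq_splits1 (W : nmodType) a (F G : seq T -> seq T -> W) :
  (forall x u v, a = x :: u ++ v -> F (x :: u) v = G (x :: u) v) ->
  splits1 a F = splits1 a G.
Proof. by case: a => //= x a e; apply: eq_splits => u v ea; apply: e; rewrite ea. Qed.

Lemma splits_eq0 (W : nmodType) a (F : seq T -> seq T -> W) :
  (forall u v, a = u ++ v -> F u v = 0) -> splits a F = 0.
Proof.
elim: a F => [|x a IH] F e /=; first exact: e.
by rewrite e // IH ?addr0 // => u v ea; apply: e; rewrite ea.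
Qed.

Lemma splits1_eq0 (W : nmodType) a (F : seq T -> seq T -> W) :
  (forall x u v, a = x :: u ++ v -> F (x :: u) v = 0) -> splits1 a F = 0.
Proof. by case: a => //= x a e; apply: splits_eq0 => u v ea; apply: e; rewrite ea. Qed.

Lemma splits_splits1 (W : nmodType) a (F : seq T -> seq T -> W) :
  F [::] a = 0 -> splits a F = splits1 a F.
Proof. by case: a => //= x a ->; rewrite add0r. Qed.

Lemma splitsD (W : nmodType) a (F G : seq T -> seq T -> W) :
  splits a (fun u v => F u v + G u v) = splits a F + splits a G.
Proof. by elim: a F G => [|x a IH] F G //=; rewrite IH addrACA. Qed.

Lemma splits1D (W : nmodType) a (F G : seq T -> seq T -> W) :
  splits1 a (fun u v => F u v + G u v) = splits1 a F + splits1 a G.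
Proof. by case: a => [|x a] /=; rewrite ?addr0 // splitsD. Qed.

Lemma splitsN (W : zmodType) a (F : seq T -> seq T -> W) :
  splits a (fun u v => - F u v) = - splits a F.
Proof. by elim: a F => [|x a IH] F //=; rewrite IH opprD. Qed.

Lemma splits_map (L : pzRingType) (V W : lmodType L) (h : V -> W) a F :
  linear h -> h (splits a F) = splits a (fun u v => h (F u v)).
Proof. by move=> lin; elim: a F => [|x a IH] F //=; rewrite (linD lin) IH. Qed.

Lemma splits1_map (L : pzRingType) (V W : lmodType L) (h : V -> W) a F :
  linear h -> h (splits1 a F) = splits1 a (fun u v => h (F u v)).
Proof. by move=> lin; case: a => [|x a] /=; rewrite ?(lin0 lin) // splits_map. Qed.

Lemma splitsA (W : nmodType) a (F : seq T -> seq T -> seq T -> W) :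
  splits a (fun u v => splits v (F u)) =
  splits a (fun u w => splits u (fun u1 u2 => F u1 u2 w)).
Proof.
elim: a F => [|x a IH] F //=.
by rewrite splitsD IH !addrA.
Qed.

Lemma splitsE (W : nmodType) a (F : seq T -> seq T -> W) :
  splits a F = \sum_(0 <= k < (size a).+1) F (take k a) (drop k a).
Proof.
elim: a F => [|x a IH] F /=; first by rewrite big_nat1.
by rewrite big_nat_recl //= IH.
Qed.

Lemma splits1E (W : nmodType) a (F : seq T -> seq T -> W) :
  splits1 a F = \sum_(1 <= k < (size a).+1) F (take k a) (drop k a).
Proof.
case: a => [|x a] /=; first by rewrite big_geq.
by rewrite splitsE big_add1.
Qed.

End Splits.

Section Multilinear.
Variables (L : comPzRingType).
Implicit Types V W P Q : lmodType L.

Lemma linear_sum_fun V W (h1 h2 : V -> W) : linear h1 -> linear h2 ->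
  linear (fun x => h1 x + h2 x).
Proof. by move=> l1 l2 c x y; rewrite l1 l2 scalerDr addrACA. Qed.

Lemma linear_opp_fun V W (h : V -> W) : linear h -> linear (fun x => - h x).
Proof. by move=> l c x y; rewrite l opprD scalerN. Qed.

Lemma linear_zero_fun V W : linear (fun _ : V => 0 : W).
Proof. by move=> c x y; rewrite scaler0 addr0. Qed.

Lemma linear_scale_fun V W c (h : V -> W) : linear h -> linear (fun x => c *: h x).
Proof. by move=> l d x y; rewrite l scalerDr !scalerA mulrC. Qed.

Lemma linear_splits (T : Type) V W a (F : V -> seq T -> seq T -> W) :
  (forall u v, linear (fun x => F x u v)) -> linear (fun x => splits a (F x)).
Proof.
elim: a F => [|y a IH] F lin /=; first exact: lin.
by apply: linear_sum_fun (lin _ _) (IH _ _) => u v; apply: lin.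
Qed.

Lemma linear_splits1 (T : Type) V W a (F : V -> seq T -> seq T -> W) :
  (forall u v, linear (fun x => F x u v)) -> linear (fun x => splits1 a (F x)).
Proof.
case: a => [|y a] lin /=; first exact: linear_zero_fun.
by apply: linear_splits => u v; apply: lin.
Qed.

Lemma multilinear_cons V W (h : seq V -> W) x :
  multilinear h -> multilinear (fun l => h (x :: l)).
Proof. by move=> ml s1 s2; apply: (ml (x :: s1)). Qed.

Lemma multilinear_splits V W (F : seq V -> seq V -> W) :
  (forall v, multilinear (F^~ v)) -> (forall u, multilinear (F u)) ->
  multilinear (fun a => splits a F).
Proof.
move=> ml mr s1 s2; elim: s1 F ml mr => [|y s1 IH] F ml mr /=.
  apply: linear_sum_fun; first exact: (mr [::] [::] s2).
  by apply: linear_splits => u v; exact: (ml v [::] u).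
apply: linear_sum_fun; first exact: (mr [::] (y :: s1) s2).
exact: (IH (fun u v => F (y :: u) v) (fun v => multilinear_cons y (ml v))
  (fun u => mr (y :: u))).
Qed.

Lemma multilinear_splits1 V W (F : seq V -> seq V -> W) :
  (forall v, multilinear (F^~ v)) -> (forall u, multilinear (F u)) ->
  multilinear (fun a => splits1 a F).
Proof.
move=> ml mr [|y s1] s2 /=.
  by apply: linear_splits => u v; exact: (ml v [::] u).
exact: (@multilinear_splits _ _ (fun u v => F (y :: u) v)
  (fun v => multilinear_cons y (ml v)) (fun u => mr (y :: u))).
Qed.

Lemma multilinear_comp V W Q (h : W -> Q) (m : seq V -> W) :
  linear h -> multilinear m -> multilinear (fun l => h (m l)).
Proof. by move=> lin ml s1 s2 c x y; rewrite ml lin. Qed.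

Lemma multilinearD V W (m1 m2 : seq V -> W) :
  multilinear m1 -> multilinear m2 -> multilinear (fun l => m1 l + m2 l).
Proof. by move=> h1 h2 s1 s2; apply: linear_sum_fun. Qed.

Lemma multilinear_map V W Q (h : V -> W) (m : seq W -> Q) :
  linear h -> multilinear m -> multilinear (fun l => m (map h l)).
Proof. by move=> lin ml s1 s2 c x y; rewrite !map_cat /= lin ml. Qed.

Lemma multilinear_scale_all V W (m : seq V -> W) c u w :
  multilinear m -> m (map ( *:%R c) u ++ w) = c ^+ size u *: m (u ++ w).
Proof.
elim: u m => [|x u IH] m ml /=; first by rewrite scale1r.
rewrite (linZ (ml [::] _)) /= (IH (fun l => m (x :: l))); last first.
  exact: multilinear_cons.
by rewrite scalerA exprS.
Qed.

Lemma multilinear2_comp V P Q W (h : Q -> W) (m : seq V -> P -> Q) :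
  linear h -> multilinear2 m -> multilinear2 (fun l b => h (m l b)).
Proof.
move=> lin [ml mr]; split=> [b|s]; first exact: multilinear_comp.
by move=> c x y; rewrite mr lin.
Qed.

Lemma multilinear2D V P Q (m1 m2 : seq V -> P -> Q) :
  multilinear2 m1 -> multilinear2 m2 -> multilinear2 (fun l b => m1 l b + m2 l b).
Proof.
move=> [l1 r1] [l2 r2]; split=> [b|s]; first exact: multilinearD.
exact: linear_sum_fun.
Qed.

Lemma multilinear2_cons V P Q (m : seq V -> P -> Q) x :
  multilinear2 m -> multilinear2 (fun l => m (x :: l)).
Proof.
move=> [ml mr]; split=> [b|s]; last exact: mr.
exact: (multilinear_cons x (ml b)).
Qed.

End Multilinear.

Section Suspension.
Variables (L : comPzRingType).
Implicit Types M P N : gmod L.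

Definition shat M (x : M) : M := - hat x.

Lemma shat_linear M : linear (@shat M).
Proof. by move=> c x y; rewrite /shat (hat_linear c x y) opprD scalerN. Qed.

Lemma shatK M (x : M) : shat (shat x) = x.
Proof. by rewrite /shat (linearN (@hat L M)) /= opprK hatK. Qed.

Lemma map_shatK M (a : seq M) : map (@shat M) (map (@shat M) a) = a.
Proof. by rewrite -map_comp -[RHS]map_id; apply: eq_map => x /=; rewrite shatK. Qed.

Lemma map_shat M (a : seq M) :
  map (@shat M) a = map ( *:%R (-1)) (map (@hat L M) a).
Proof. by rewrite -map_comp; apply: eq_map => x /=; rewrite scaleN1r. Qed.

Lemma eq_multilinear_homogeneous M (W : lmodType L) (h1 h2 : seq M -> W) :
  multilinear h1 -> multilinear h2 ->
  (forall q a, (0 < size a)%N -> homogeneous q a -> h1 a = h2 a) ->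
  forall a, (0 < size a)%N -> h1 a = h2 a.
Proof.
move=> m1 m2 e a a0.
suff H u w q : (0 < size (u ++ w))%N -> homogeneous q u -> h1 (u ++ w) = h2 (u ++ w).
  exact: (H [::] a [::] a0 (List.Forall2_nil _)).
elim: w u q {a a0} => [|x w IH] u q; first by rewrite cats0; apply: e.
move=> _ hu; have [[n c] /= [hc ->]] := gpart_span x.
elim: n => [|n IHn].
  by rewrite big_ord0 (lin0 (m1 u w)) (lin0 (m2 u w)).
rewrite big_ord_recr /= (linD (m1 u w)) (linD (m2 u w)) IHn.
congr (_ + _); rewrite -cat_rcons; apply: (IH _ (rcons q n)).
  by rewrite size_cat size_rcons.
rewrite -!cats1; apply: List.Forall2_app => //.
by apply: List.Forall2_cons (hc n) (List.Forall2_nil _).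
Qed.

Lemma map_hat_homogeneous M q (a : seq M) (W : lmodType L) (h : seq M -> W) :
  multilinear h -> homogeneous q a ->
  h (map (@hat L M) a) = (-1) ^+ sumn q *: h a.
Proof.
move=> ml ha; elim: ha h ml => [|r x {}q {}a hx _ IH] h ml /=.
  by rewrite scale1r.
rewrite (hat_homog hx) (linZ (ml [::] _)) /=.
rewrite (IH (fun l => h (x :: l))); last exact: multilinear_cons.
by rewrite scalerA exprD.
Qed.

Lemma gpartz_hat M z (x : M) : gpartz z x -> hat x = (-1) ^+ `|z|%N *: x.
Proof.
by case: z => [q|q] /=; [apply: hat_homog | move=> ->; rewrite linear0 scaler0].
Qed.

Lemma shat_has_degree M N d (h : seq M -> N) :
  multilinear h -> has_degree d h -> forall a, (0 < size a)%N ->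
  shat (h a) = (-1) ^+ `|d|.+1 *: h (map (@shat M) a).
Proof.
move=> ml hd; apply: eq_multilinear_homogeneous.
- exact: multilinear_comp (@shat_linear N) ml.
- apply: multilinear_comp (multilinear_map (@shat_linear M) ml).
  exact: (linear_scale_fun _ (fun c x y => erefl)).
move=> q a a0 ha; rewrite /shat (gpartz_hat (hd q a a0 ha)).
rewrite map_shat -[map _ (map _ _)]cats0 multilinear_scale_all // cats0 size_map.
rewrite (map_hat_homogeneous ml ha) !scalerA -scaleN1r scalerA -exprS -!exprD.
congr (_ *: _); rewrite -[LHS]signr_odd -[RHS]signr_odd; congr (_ ^+ (nat_of_bool _)).
lia.
Qed.

End Suspension.

(** * The bar differential *)

Section BarDifferential.
Variables (L : comPzRingType) (M : gmod L) (P : lmodType L).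
Variables (X : seq M -> M) (p : seq M -> P -> P).
Implicit Types (W Z : lmodType L) (a u v w : seq M) (b : P).

Let s : M -> M := @shat L M.

(* [ins h] and [dom phi] are the composites of [h] and [phi] with the
   differentials of the bar constructions of [(M, X)] and [(P, p)]. *)
Definition ins W (h : seq M -> W) a : W :=
  splits a (fun u v => splits1 v (fun v1 w => h (map s u ++ X v1 :: w))).

Definition dom W (phi : seq M -> P -> W) a b : W :=
  ins (phi^~ b) a + splits a (fun u v => phi (map s u) (p v b)).

Lemma eq_ins W (h1 h2 : seq M -> W) a :
  (forall l, (0 < size l)%N -> h1 l = h2 l) -> ins h1 a = ins h2 a.
Proof.
move=> e; apply: eq_splits => u v _; apply: eq_splits1 => x v1 w _.
by apply: e; rewrite size_cat addnS.
Qed.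

Lemma ins_cons W (h : seq M -> W) x a :
  ins h (x :: a) = splits1 (x :: a) (fun v w => h (X v :: w))
                   + ins (fun l => h (s x :: l)) a.
Proof. by []. Qed.

Lemma dom_nil W (phi : seq M -> P -> W) b : dom phi [::] b = phi [::] (p [::] b).
Proof. by rewrite /dom /ins /= add0r. Qed.

Lemma dom_cons W (phi : seq M -> P -> W) x a b :
  dom phi (x :: a) b = splits1 (x :: a) (fun v w => phi (X v :: w) b)
    + phi [::] (p (x :: a) b) + dom (fun l => phi (s x :: l)) a b.
Proof. by rewrite /dom ins_cons /= addrACA. Qed.

Lemma domD W (phi chi : seq M -> P -> W) a b :
  dom (fun l c => phi l c + chi l c) a b = dom phi a b + dom chi a b.
Proof.
rewrite /dom addrACA -splitsD; congr (_ + _).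
by rewrite -splitsD; apply: eq_splits => u v _; rewrite -splits1D.
Qed.

Lemma domN W (phi : seq M -> P -> W) a b :
  dom (fun l c => - phi l c) a b = - dom phi a b.
Proof.
apply/eqP; rewrite -addr_eq0 -domD; apply/eqP.
rewrite /dom /ins !splits_eq0 ?addr0 // => u v _; first by rewrite addNr.
by apply: splits1_eq0 => x u' v' _; rewrite addNr.
Qed.

Lemma ins_comp W Z (h : W -> Z) (m : seq M -> W) a :
  linear h -> h (ins m a) = ins (fun l => h (m l)) a.
Proof.
move=> lin; rewrite /ins (splits_map _ _ lin).
by apply: eq_splits => u v _; rewrite (splits1_map _ _ lin).
Qed.

Lemma dom_comp W Z (h : W -> Z) (phi : seq M -> P -> W) a b :
  linear h -> h (dom phi a b) = dom (fun l c => h (phi l c)) a b.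
Proof.
by move=> lin; rewrite /dom (linD lin) (splits_map _ _ lin) (ins_comp _ _ lin).
Qed.

Lemma multilinear_ins W (h : seq M -> W) :
  multilinear X -> multilinear h -> multilinear (ins h).
Proof.
move=> mX mh; apply: multilinear_splits => [v|u].
  move=> s1 s2; apply: linear_splits1 => v1 w c x y.
  by rewrite !map_cat /= /s (shat_linear c x y) -!catA !cat_cons mh.
apply: multilinear_splits1 => [w|v1] s1 s2 c x y.
  by rewrite mX mh.
by rewrite -!cat_cons !catA mh.
Qed.

Lemma multilinear2_dom W (phi : seq M -> P -> W) :
  multilinear X -> multilinear2 p -> multilinear2 phi -> multilinear2 (dom phi).
Proof.
move=> mX [pl pr] [ml mr]; split=> [b|a]; last first.
  apply: linear_sum_fun; apply: linear_splits => u v; last first.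
    by move=> c x y; rewrite pr mr.
  by apply: linear_splits1 => v1 w; apply: mr.
apply: multilinearD; first by apply: multilinear_ins.
apply: multilinear_splits => [v|u].
  exact: multilinear_map (@shat_linear _ _) (ml _).
exact: multilinear_comp (mr _) (pl b).
Qed.

Lemma dom_splits W Z (G : seq M -> Z) (Phi : Z -> seq M -> P -> W) a b :
  (forall w c, linear (fun z => Phi z w c)) ->
  dom (fun l c => splits l (fun v w => Phi (G v) w c)) a b =
  splits a (fun v w => Phi (ins G v) w b)
  + splits a (fun v w => dom (Phi (G (map s v))) w b).
Proof.
move=> lin; elim: a G => [|x a IH] G.
  by rewrite /= !dom_nil /= (lin0 (lin _ _)) add0r.
rewrite dom_cons /=.
rewrite (domD (fun l => Phi (G [::]) (s x :: l))
  (fun l c => splits l (fun v w => Phi (G (s x :: v)) w c))).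
rewrite (IH (fun v => G (s x :: v))) /= (lin0 (lin _ _)) add0r.
rewrite dom_cons splitsD /=.
have -> : splits a (fun v w => Phi (ins G (x :: v)) w b) =
    splits a (fun v w => splits w (fun w1 w2 => Phi (G (X (x :: v) :: w1)) w2 b))
    + splits a (fun v w => Phi (ins (fun l => G (s x :: l)) v) w b).
  rewrite splitsA -splitsD; apply: eq_splits => v w _.
  rewrite ins_cons (linD (lin _ _)); congr (_ + _).
  by rewrite (splits1_map _ _ (lin w b)).
by rewrite [LHS](AC (3*(1*2)) ((2*5)*(1*3*4*6))).
Qed.

Hypotheses (mX : multilinear X) (dX : has_degree (-2) X).
Hypothesis relX : forall a, (0 < size a)%N -> ins X a = 0.

Lemma X_shat a : (0 < size a)%N -> X (map s a) = - s (X a).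
Proof.
by move=> a0; rewrite [s (X a)](shat_has_degree mX dX a0) -signr_odd /= scaleN1r opprK.
Qed.

Lemma dom_dom W (phi : seq M -> P -> W) a b : multilinear2 phi ->
  dom (dom phi) a b = splits a (fun u v => phi u (dom p v b)).
Proof.
move=> mphi; have [ml mr] := mphi; elim: a phi mphi ml mr => [|x a IH] phi mphi ml mr.
  by rewrite /= !dom_nil.
have e1 : splits a (fun u v => dom phi (X (x :: u) :: v) b) =
    splits a (fun u v => splits v (fun v1 w => phi (X (X (x :: u) :: v1) :: w) b))
    + splits a (fun u v => phi [::] (p (X (x :: u) :: v) b))
    + splits a (fun u v => dom (fun l => phi (s (X (x :: u)) :: l)) v b).
  by rewrite -!splitsD; apply: eq_splits => u v _; rewrite dom_cons.
have e2 : dom (fun l => dom phi (s x :: l)) a b =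
    dom (fun l c => splits l (fun u v => phi (X (s x :: u) :: v) c)) a b
    + dom (fun l c => phi [::] (p (s x :: l) c)) a b
    + dom (dom (fun l => phi (x :: l))) a b.
  rewrite -!domD; congr (dom _ a b); apply/funext => l; apply/funext => c.
  by rewrite dom_cons /= /s shatK.
have e3 : dom (fun l c => splits l (fun u v => phi (X (s x :: u) :: v) c)) a b =
    splits a (fun v w => phi (ins (fun u => X (s x :: u)) v :: w) b)
    - splits a (fun u v => dom (fun l => phi (s (X (x :: u)) :: l)) v b).
  rewrite (dom_splits (fun u => X (s x :: u)) (Phi := fun z w => phi (z :: w))).
    rewrite -splitsN; congr (_ + _); apply: eq_splits => u v _.
    rewrite -domN; congr (dom _ _ _); apply/funext => l; apply/funext => c.
    by rewrite -(linN (ml c [::] l)) -X_shat.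
  by move=> w c; apply: (ml c [::]).
have e4 : splits a (fun u v => splits v (fun v1 w => phi (X (X (x :: u) :: v1) :: w) b))
    + splits a (fun v w => phi (ins (fun u => X (s x :: u)) v :: w) b) = 0.
  rewrite splitsA -splitsD; apply: splits_eq0 => u v _.
  rewrite -(splits_map u _ (ml b [::] v)) /= -(linD (ml b [::] v)).
  by have := relX (a := x :: u) isT; rewrite ins_cons /= => ->; apply: lin0 (ml b [::] v).
have e5 : phi [::] (dom p (x :: a) b) =
    splits a (fun u v => phi [::] (p (X (x :: u) :: v) b))
    + phi [::] (p [::] (p (x :: a) b))
    + dom (fun l c => phi [::] (p (s x :: l) c)) a b.
  rewrite dom_cons 2!(linD (mr [::])) /= (splits_map _ _ (mr [::])).
  by rewrite (dom_comp _ _ _ (mr [::])).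
have mx := multilinear2_cons x mphi.
have e6 := IH (fun l => phi (x :: l)) mx mx.1 mx.2.
rewrite dom_cons /= e1 e2 e3 e6 e5 dom_nil.
have <- := addr0_eq e4.
set A := splits _ _; set B := splits _ _; set C := splits _ _; set D := splits _ _.
rewrite [LHS](AC (4*4) (((1*5)*(3*6))*(2*4*7*8))).
by rewrite /= !subrr !add0r.
Qed.

End BarDifferential.

Lemma diff_shat (L : comPzRingType) (D : dgmod L) (x : D) :
  diff (shat x) = - shat (diff x).
Proof. by rewrite /shat diffN diff_hat. Qed.

Lemma shat_op (L : comPzRingType) (D E F : dgmod L) (op : D -> E -> F) x y :
  dg_pairing op -> shat (op x y) = - op (shat x) (shat y).
Proof.
by move=> h; rewrite /shat (hat_op h) (pairingNl h) (pairingNr h) opprK.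
Qed.

Section MorphismDefect.
Variables (L : comPzRingType) (C : dgalg L) (D : dgamod C).
Variables (M : gmod L) (P : lmodType L).
Variables (X : seq M -> M) (p : seq M -> P -> P) (f : seq M -> C).
Hypotheses (mX : multilinear X) (dX : has_degree (-2) X).
Hypothesis relX : forall a, (0 < size a)%N -> ins X X a = 0.
Hypotheses (mf : multilinear f) (df : has_degree (-1) f) (f0 : f [::] = 0).
Hypothesis relf : forall a, (0 < size a)%N ->
  ins X f a = diff (f a) + splits a (fun u v => dga_mul (shat (f u)) (f v)).
Implicit Types (phi : seq M -> P -> D) (a u v w : seq M) (b : P).

Let actP := dgm_pairing D.
Let mulP := dga_pairing C.

(* The two sides of the equation defining morphisms of [M(oo)] differ by
   [defect phi]. *)
Definition defect phi a b : D :=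
  dom X p phi a b
  - (diff (phi a b) + splits a (fun u v => dgm_act (shat (f u)) (phi v b))).

Lemma f_shat a : shat (f (map (@shat L M) a)) = f a.
Proof.
case: a => [|x a]; first by rewrite /= f0 (lin0 (@shat_linear _ _)).
rewrite (shat_has_degree mf df) // map_shatK -signr_odd /=.
by rewrite scale1r.
Qed.

Lemma defect_identity phi a b : multilinear2 phi ->
  diff (defect phi a b) + splits a (fun u v => dgm_act (f u) (defect phi v b))
  + dom X p (defect phi) a b
  = splits a (fun u v => phi u (dom X p p v b)).
Proof.
move=> mphi; rewrite -(dom_dom p mX dX relX _ _ mphi).
pose T (psi : seq M -> P -> D) a b := splits a (fun u v => dgm_act (shat (f u)) (psi v b)).
pose T' (psi : seq M -> P -> D) a b := splits a (fun u v => dgm_act (f u) (psi v b)).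
have e1 : diff (defect phi a b) = diff (dom X p phi a b) - diff (T phi a b).
  rewrite /defect (linD (@diff_linear _ _)) diffN (linD (@diff_linear _ _)).
  by rewrite diffK add0r.
have e2 : T' (defect phi) a b =
    T' (dom X p phi) a b - T' (fun l c => diff (phi l c)) a b - T' (T phi) a b.
  rewrite /T' -!splitsN -!splitsD; apply: eq_splits => u v _.
  by rewrite /defect (linB (pairing_linearr actP _)) (linD (pairing_linearr actP _)) opprD addrA.
have e3 : dom X p (defect phi) a b =
    dom X p (dom X p phi) a b - diff (dom X p phi a b) - dom X p (T phi) a b.
  rewrite (dom_comp _ _ _ _ _ (@diff_linear _ _)) -!domN -!domD.
  congr (dom X p _ a b); apply/funext => l; apply/funext => c.
  by rewrite /defect opprD addrA.
have eT : T' (T phi) a b = splits a (fun u w =>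
    dgm_act (splits u (fun u1 u2 => dga_mul (f u1) (shat (f u2)))) (phi w b)).
  transitivity (splits a (fun u v => splits v (fun v1 w =>
      dgm_act (dga_mul (f u) (shat (f v1))) (phi w b)))).
    apply: eq_splits => u v _; rewrite /T.
    rewrite (splits_map _ _ (pairing_linearr actP (f u))).
    by apply: eq_splits => v1 w _; rewrite dgm_actA.
  rewrite splitsA; apply: eq_splits => u w _.
  by rewrite (splits_map _ _ (pairing_linearl actP (phi w b))).
have e4 : dom X p (T phi) a b =
    splits a (fun u v => dgm_act (shat (diff (f u))) (phi v b)) - T' (T phi) a b
    + T' (dom X p phi) a b.
  rewrite eT /T (dom_splits X p (fun u => shat (f u))
    (Phi := fun z w c => dgm_act z (phi w c))); last first.
    by move=> w c; apply: (pairing_linearl actP).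
  congr (_ + _); last first.
    apply: eq_splits => u v _ /=; rewrite f_shat.
    by rewrite (dom_comp _ _ _ _ _ (pairing_linearr actP (f u))).
  rewrite -splitsN -splitsD; apply: eq_splits => u w _.
  rewrite -(linB (pairing_linearl actP (phi w b))); congr (dgm_act _ _).
  case: u => [|x u].
    rewrite /= f0 (lin0 (@diff_linear _ _)) (lin0 (@shat_linear _ _)).
    by rewrite (lin0 (pairing_linearl mulP _)) subr0.
  rewrite -(ins_comp _ _ _ (@shat_linear _ C)) relf // (linD (@shat_linear _ C)).
  congr (_ + _); rewrite (splits_map _ _ (@shat_linear _ C)) -splitsN.
  by apply: eq_splits => u1 u2 _; rewrite (shat_op _ _ mulP) shatK.
have e5 : diff (T phi a b) =
    - splits a (fun u v => dgm_act (shat (diff (f u))) (phi v b))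
    - T' (fun l c => diff (phi l c)) a b.
  rewrite /T (splits_map _ _ (@diff_linear _ _)) -!splitsN -splitsD.
  apply: eq_splits => u v _; rewrite (pairing_leibniz actP) diff_shat.
  rewrite (linN (pairing_linearl actP _)); congr (_ + _).
  by rewrite -(linN (pairing_linearl actP _)) -[in RHS](shatK (f u)) /shat opprK.
rewrite -/(T' (defect phi) a b) e1 e2 e3 e4 e5.
set A := diff _; set B := splits _ _; set C1 := T' _ _ _; set E1 := T' _ _ _.
set F := T' _ _ _; set G := dom _ _ _ _ _.
rewrite !opprD !opprK.
rewrite [LHS](AC ((1*2)*3*(2*3)) (7*((1*8)*(2*9)*(3*5)*(4*11)*(6*10)))) /=.
by rewrite !subrr addNr !addr0.
Qed.

Lemma multilinear2_defect phi :
  multilinear2 p -> multilinear2 phi -> multilinear2 (defect phi).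
Proof.
move=> mp mphi; apply: multilinear2D; first exact: multilinear2_dom.
split=> [b|a].
  apply: (multilinear_comp (h := fun x : D => - x)).
    by apply: linear_opp_fun.
  apply: multilinearD; first exact: multilinear_comp (@diff_linear _ _) (mphi.1 b).
  apply: multilinear_splits => [v|u].
    exact: (multilinear_comp (pairing_linearl actP (phi v b))
      (multilinear_comp (@shat_linear _ _) mf)).
  exact: multilinear_comp (pairing_linearr actP _) (mphi.1 b).
apply: linear_opp_fun; apply: linear_sum_fun.
  by move=> c x y; rewrite mphi.2 (@diff_linear _ _).
by apply: linear_splits => u v c x y; rewrite mphi.2 (pairing_linearr actP).
Qed.

End MorphismDefect.

(** * Locality and degrees *)

Section Locality.
Variables (L : comPzRingType) (M : gmod L) (P : lmodType L) (X : seq M -> M).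
Implicit Types (W : lmodType L) (p : seq M -> P -> P) (a : seq M) (b : P).

Lemma dom_local W p1 p2 (phi1 phi2 : seq M -> P -> W) a b :
  (forall l, (size l <= size a)%N -> phi1 l = phi2 l) ->
  (forall l, (size l <= size a)%N -> p1 l = p2 l) ->
  dom X p1 phi1 a b = dom X p2 phi2 a b.
Proof.
move=> ephi ep; congr (_ + _); apply: eq_splits => u v ea.
  apply: eq_splits1 => x v1 w ev; rewrite ephi //.
  by rewrite ea ev !size_cat /= size_map !size_cat; lia.
have su : (size u <= size a)%N by rewrite ea size_cat leq_addr.
have sv : (size v <= size a)%N by rewrite ea size_cat leq_addl.
by rewrite ephi ?size_map // ep.
Qed.

Hypothesis X1 : forall x, X [:: x] = 0.

Lemma dom_local_lt W p1 p2 (phi1 phi2 : seq M -> P -> W) a b :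
  multilinear2 phi1 -> multilinear2 phi2 ->
  (forall c, p1 [::] c = 0) -> (forall c, p2 [::] c = 0) -> (0 < size a)%N ->
  (forall l, (size l < size a)%N -> phi1 l = phi2 l) ->
  (forall l, (size l < size a)%N -> p1 l = p2 l) ->
  dom X p1 phi1 a b - phi1 [::] (p1 a b) = dom X p2 phi2 a b - phi2 [::] (p2 a b).
Proof.
move=> [ml1 mr1] [ml2 mr2] p10 p20; case: a => // x a _ ephi ep.
rewrite /dom /= ![_ (p1 _ b) + _]addrC ![_ (p2 _ b) + _]addrC !addrA !addrK.
congr (_ + _).
  apply: eq_splits => u v ea; apply: eq_splits1 => y [|z v1] w ev.
    by rewrite X1 (lin0 (ml1 b _ w)) (lin0 (ml2 b _ w)).
  rewrite ephi // ea ev !size_cat /= size_map size_cat; lia.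
apply: eq_splits => u v ea; case: v ea => [|y v] ea.
  by rewrite p10 p20 (lin0 (mr1 _)) (lin0 (mr2 _)).
by rewrite ephi ?ep //= ea size_cat ?size_map /=; lia.
Qed.

End Locality.

Section DefectLocality.
Variables (L : comPzRingType) (C : dgalg L) (D : dgamod C).
Variables (M : gmod L) (P : lmodType L) (X : seq M -> M) (f : seq M -> C).
Hypotheses (X1 : forall x, X [:: x] = 0) (f0 : f [::] = 0).
Implicit Types (p : seq M -> P -> P) (phi : seq M -> P -> D) (a : seq M) (b : P).

Lemma act_shat_f0 (y : D) : dgm_act (shat (f [::])) y = 0.
Proof.
by rewrite f0 (lin0 (@shat_linear _ _)) (lin0 (pairing_linearl (dgm_pairing D) _)).
Qed.

Lemma defect_local p1 p2 phi1 phi2 a b :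
  (forall l, (size l <= size a)%N -> phi1 l = phi2 l) ->
  (forall l, (size l <= size a)%N -> p1 l = p2 l) ->
  defect X p1 f phi1 a b = defect X p2 f phi2 a b.
Proof.
move=> ephi ep; rewrite /defect (dom_local _ _ ephi ep) ephi //.
congr (_ - (_ + _)); apply: eq_splits => u v ea; rewrite ephi //.
by rewrite ea size_cat leq_addl.
Qed.

Lemma defect_local_lt p1 p2 phi1 phi2 a b :
  multilinear2 phi1 -> multilinear2 phi2 ->
  (forall c, p1 [::] c = 0) -> (forall c, p2 [::] c = 0) -> (0 < size a)%N ->
  (forall l, (size l < size a)%N -> phi1 l = phi2 l) ->
  (forall l, (size l < size a)%N -> p1 l = p2 l) ->
  defect X p1 f phi1 a b - phi1 [::] (p1 a b) + diff (phi1 a b)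
  = defect X p2 f phi2 a b - phi2 [::] (p2 a b) + diff (phi2 a b).
Proof.
move=> m1 m2 p10 p20 a0 ephi ep; rewrite /defect !opprD.
have -> : splits a (fun u v => dgm_act (shat (f u)) (phi1 v b))
          = splits a (fun u v => dgm_act (shat (f u)) (phi2 v b)).
  apply: eq_splits => -[|x u] v ea; first by rewrite !act_shat_f0.
  by rewrite ephi // ea /= size_cat; lia.
rewrite [LHS](AC (1*2*1*1) ((1*4)*(5*2)*3)) [RHS](AC (1*2*1*1) ((1*4)*(5*2)*3)) /=.
by rewrite !subrr (dom_local_lt X1 _ m1 m2 p10 p20 a0 ephi ep).
Qed.

End DefectLocality.

Section Degrees.
Variable L : comPzRingType.
Implicit Types (M N P Q : gmod L).

Lemma gpartz0 M z : @gpartz L M z 0.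
Proof. by case: z => //= n; apply: gpart0. Qed.

Lemma gpartz_neg M n (x : M) : gpartz (Negz n) x -> x = 0.
Proof. by []. Qed.

Lemma gpartzD M z (x y : M) : gpartz z x -> gpartz z y -> gpartz z (x + y).
Proof. by case: z => [n|n] /=; [apply: gpartD | move=> -> ->; rewrite addr0]. Qed.

Lemma gpartzZ M z c (x : M) : gpartz z x -> gpartz z (c *: x).
Proof. by case: z => [n|n] /=; [apply: gpartZ | move=> ->; rewrite scaler0]. Qed.

Lemma gpartzN M z (x : M) : gpartz z x -> gpartz z (- x).
Proof. by rewrite -scaleN1r; apply: gpartzZ. Qed.

Lemma gpartz_shat M z (x : M) : gpartz z x -> gpartz z (shat x).
Proof. by move=> hx; apply: gpartzN; rewrite (gpartz_hat hx); apply: gpartzZ. Qed.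

Lemma gpartz_diff (D : dgmod L) z (x : D) : gpartz z x -> gpartz (z - 1) (diff x).
Proof.
case: z => [n|n]; first exact: diff_deg.
by move/gpartz_neg->; rewrite (lin0 (@diff_linear _ D)); apply: gpartz0.
Qed.

Lemma gpartz_op (D E F : dgmod L) (op : D -> E -> F) z t x y : dg_pairing op ->
  gpartz z x -> gpartz t y -> gpartz (z + t) (op x y).
Proof.
move=> h; case: z => [n|n]; last first.
  by move=> /gpartz_neg-> _; rewrite (lin0 (pairing_linearl h _)); apply: gpartz0.
case: t => [m|m]; last first.
  by move=> _ /gpartz_neg->; rewrite (lin0 (pairing_linearr h _)); apply: gpartz0.
exact: pairing_deg.
Qed.

Lemma gpartz_splits T M z (a : seq T) (F : seq T -> seq T -> M) :
  (forall u v, a = u ++ v -> gpartz z (F u v)) -> gpartz z (splits a F).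
Proof.
elim: a F => [|x a IH] F h /=; first exact: h.
by apply: gpartzD; [apply: h | apply: IH => u v ea; apply: h; rewrite ea].
Qed.

Lemma gpartz_splits1 T M z (a : seq T) (F : seq T -> seq T -> M) :
  (forall x u v, a = x :: u ++ v -> gpartz z (F (x :: u) v)) ->
  gpartz z (splits1 a F).
Proof.
case: a => [|x a] h /=; first exact: gpartz0.
by apply: gpartz_splits => u v ea; apply: h; rewrite ea.
Qed.

Lemma homogeneous_cat M q (u v : seq M) : homogeneous q (u ++ v) ->
  exists q1 q2, [/\ q = q1 ++ q2, homogeneous q1 u & homogeneous q2 v].
Proof.
move=> /List.Forall2_app_inv_r[q1 [q2 [h1 [h2 ->]]]].
by exists q1, q2.
Qed.

Lemma homogeneous_map_shat M q (u : seq M) :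
  homogeneous q u -> homogeneous q (map (@shat L M) u).
Proof.
elim=> [|n x {}q {}u hx _ IH] /=; first exact: List.Forall2_nil.
by apply: List.Forall2_cons IH; apply: (gpartz_shat (z := n)).
Qed.

Lemma has_degree_gpartz M N d (h : seq M -> N) q1 q2 u w z x :
  multilinear h -> has_degree d h ->
  homogeneous q1 u -> homogeneous q2 w -> gpartz z x ->
  gpartz ((sumn q1 + sumn q2)%N%:Z + z + (size u + size w).+1%:Z + d)
    (h (u ++ x :: w)).
Proof.
move=> mh dh h1 h2; case: z => [n|n] hx; last first.
  by rewrite (gpartz_neg hx) (lin0 (mh u w)); apply: gpartz0.
have a0 : (0 < size (u ++ x :: w))%N by rewrite size_cat addnS.
have := dh (q1 ++ n :: q2) _ a0 (List.Forall2_app h1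
  (List.Forall2_cons _ _ (hx : gpart n x) h2)).
by congr gpartz; rewrite sumn_cat size_cat /=; lia.
Qed.

Lemma has_degree2_gpartz M P Q d (phi : seq M -> P -> Q) q u z y :
  multilinear2 phi -> has_degree2 d phi -> homogeneous q u -> gpartz z y ->
  gpartz ((sumn q)%:Z + z + (size u).+1%:Z + d) (phi u y).
Proof.
move=> [_ mr] dphi h1; case: z => [n|n] hy; last first.
  by rewrite (gpartz_neg hy) (lin0 (mr u)); apply: gpartz0.
by have := dphi _ _ _ _ h1 hy; rewrite PoszD.
Qed.

Lemma has_degree_ins M N d (X : seq M -> M) (h : seq M -> N) :
  has_degree (-2) X -> multilinear h -> has_degree d h ->
  has_degree (d - 1) (ins X h).
Proof.
move=> dX mh dh q a _ ha; apply: gpartz_splits => u v ea.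
move: ha; rewrite ea => /homogeneous_cat[q1 [q2 [-> h1 h2]]].
apply: gpartz_splits1 => x v1 w ev.
move: h2; rewrite ev -cat_cons => /homogeneous_cat[q3 [q4 [-> h3 h4]]].
have := has_degree_gpartz mh dh (homogeneous_map_shat h1) h4 (dX q3 (x :: v1) isT h3).
by congr gpartz; rewrite !sumn_cat !size_cat !size_map /= ?size_cat /=; lia.
Qed.

Lemma has_degree2_dom M P Q d (X : seq M -> M) p (phi : seq M -> P -> Q) :
  has_degree (-2) X -> has_degree2 (-2) p -> multilinear2 phi ->
  has_degree2 d phi -> has_degree2 (d - 1) (dom X p phi).
Proof.
move=> dX dp mphi dphi q r a b ha hb; apply: gpartzD; last first.
  apply: gpartz_splits => u v ea.
  move: ha; rewrite ea => /homogeneous_cat[q1 [q2 [-> h1 h2]]].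
  have := has_degree2_gpartz mphi dphi (homogeneous_map_shat h1) (dp _ _ _ _ h2 hb).
  by congr gpartz; rewrite sumn_cat size_cat size_map; lia.
case: a ha => [|x a] ha; first exact: gpartz0.
have dphi' : has_degree (r%:Z + 1 + d) (phi^~ b).
  by move=> q' a' _ ha'; have := dphi _ _ _ _ ha' hb; congr gpartz; lia.
have := has_degree_ins dX (mphi.1 b) dphi' (a := x :: a) isT ha.
by congr gpartz; lia.
Qed.

Lemma has_degree2_defect (C : dgalg L) (D : dgamod C) M P (X : seq M -> M) p
    (f : seq M -> C) (phi : seq M -> P -> D) :
  has_degree (-2) X -> has_degree2 (-2) p -> f [::] = 0 -> has_degree (-1) f ->
  multilinear2 phi -> has_degree2 (-1) phi -> has_degree2 (-2) (defect X p f phi).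
Proof.
move=> dX dp f0 df mphi dphi q r a b ha hb; apply: gpartzD.
  have := has_degree2_dom dX dp mphi dphi ha hb; congr gpartz; lia.
apply: gpartzN; apply: gpartzD.
  have := gpartz_diff (dphi _ _ _ _ ha hb); congr gpartz; lia.
apply: gpartz_splits => -[|x u] v ea.
  by rewrite act_shat_f0 //; apply: gpartz0.
move: ha; rewrite ea => /homogeneous_cat[q1 [q2 [-> h1 h2]]].
have := gpartz_op (dgm_pairing D) (gpartz_shat (df q1 (x :: u) isT h1)) (dphi _ _ _ _ h2 hb).
by congr gpartz; rewrite sumn_cat size_cat /=; lia.
Qed.

End Degrees.

(** * Graded free modules and homology classes *)

Lemma big_seq_fibers (W : nmodType) (T : Type) (K : eqType) (k : T -> K)
    (l : seq T) (s : seq K) (F : T -> W) :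
  uniq s -> all (fun t => k t \in s) l ->
  \sum_(y <- s) \sum_(t <- l | k t == y) F t = \sum_(t <- l) F t.
Proof.
move=> us; elim: l => [_|t l IH /= /andP[ks /IH{}IH]].
  by rewrite big1 ?big_nil // => y _; rewrite big_nil.
rewrite big_cons -IH (bigD1_seq (k t)) //= [in RHS](bigD1_seq (k t)) //=.
rewrite big_cons eqxx -addrA; congr (_ + (_ + _)).
by apply: eq_bigr => y /negbTE ny; rewrite big_cons eq_sym ny.
Qed.

Section GradedFree.
Variables (L : comPzRingType) (V : gmod L).
Implicit Types (v : V) (l : seq (L * V)%type).

Lemma gpart_sum (q : nat) (T : Type) (r : seq T) (p : pred T) (F : T -> V) :
  (forall i, p i -> gpart q (F i)) -> gpart q (\sum_(i <- r | p i) F i).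
Proof.
move=> h; elim/big_rec: _ => [|i x /h hi hx]; first exact: gpart0.
exact: gpartD.
Qed.

Lemma gpart_inter (q r : nat) v : gpart q v -> gpart r v -> q != r -> v = 0.
Proof.
move=> hq hr nqr; pose c i : V := if i == q then v else if i == r then - v else 0.
have hc i : gpart i (c i).
  rewrite /c; case: eqP => [->|_] //; case: eqP => [->|_]; last exact: gpart0.
  exact: gpartN.
have := @gpart_direct L V (q + r).+1 c hc.
have ltq : (q < (q + r).+1)%N by rewrite ltnS leq_addr.
have ltr : (r < (q + r).+1)%N by rewrite ltnS leq_addl.
rewrite (bigD1 (Ordinal ltq)) //= (bigD1 (Ordinal ltr)) /=; last first.
  by rewrite -val_eqE /= eq_sym.
rewrite big1 /= => [|i]; last first.
  by rewrite -!val_eqE /= /c => /andP[/negbTE-> /negbTE->].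
rewrite {1 2}/c !eqxx [r == q]eq_sym (negbTE nqr) addr0 subrr => /(_ erefl _ ltq).
by rewrite /c eqxx.
Qed.

(* A dual basis, [rep v] listing coordinates of [v] together with
   the corresponding basis vectors; linearity of every extension by
   coordinates is all that freeness is used for. *)
Definition graded_dual_basis (rep : V -> seq (L * V)) : Prop :=
  [/\ forall v, \sum_(t <- rep v) t.1 *: t.2 = v,
      forall q v, gpart q v -> forall t, t \in rep v -> gpart q t.2
    & forall (W : lmodType L) (phi : V -> W),
        linear (fun v => \sum_(t <- rep v) t.1 *: phi t.2)].

Variable B : nat -> set V.
Hypothesis basisB : forall q, is_basis_of (gpart (g := V) q) (B q).

Lemma basis_relation (W : lmodType L) (phi : V -> W) l :
  (forall t, t \in l -> exists q, B q t.2) ->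
  \sum_(t <- l) t.1 *: t.2 = 0 -> \sum_(t <- l) t.1 *: phi t.2 = 0.
Proof.
move=> hl rel.
have /choice[deg hdeg] (x : V) : exists q, (exists q', B q' x) -> B q x.
  by have [[q hq]|nex] := pselect (exists q, B q x); [exists q | exists 0%N].
have {}hl t : t \in l -> B (deg t.2) t.2 by move/hl/hdeg.
pose N := (\max_(t <- l) (deg t.2)).+1.
have hN : all (fun t => deg t.2 \in iota 0 N) l.
  apply/allP => t tl; rewrite mem_iota add0n ltnS.
  by rewrite (big_rem t) //= leq_maxl.
rewrite -(big_seq_fibers _ (iota_uniq 0 N) hN) big_seq big1 // => q.
rewrite mem_iota add0n => /andP[_ ltq].
have rq : \sum_(t <- l | deg t.2 == q) t.1 *: t.2 = 0.
  apply: (@gpart_direct L V N (fun q => \sum_(t <- l | deg t.2 == q) t.1 *: t.2)) ltq.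
    move=> r; rewrite big_seq_cond; apply: gpart_sum => t /andP[tl /eqP <-].
    by apply: gpartZ; have [sub _ _] := basisB (deg t.2); apply/sub/hl.
  rewrite -[RHS]rel -(big_seq_fibers _ (iota_uniq 0 N) hN).
  by rewrite -[iota 0 N]/(index_iota 0 N) big_mkord.
pose lq := [seq t <- l | deg t.2 == q]; pose s := undup [seq t.2 | t <- lq].
have hs : all (fun t : L * V => t.2 \in s) lq.
  by apply/allP => t tl; rewrite mem_undup map_f.
pose c x := \sum_(t <- lq | t.2 == x) t.1.
have group (U : lmodType L) (psi : V -> U) :
    \sum_(t <- l | deg t.2 == q) t.1 *: psi t.2 = \sum_(x <- s) c x *: psi x.
  rewrite -big_filter -(big_seq_fibers _ (undup_uniq _) hs).
  apply: eq_bigr => x _; rewrite scaler_suml.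
  by apply: eq_bigr => t /eqP->.
have [_ _ indep] := basisB q.
rewrite group big_seq big1 // => x xs; rewrite (indep s c _ _ _ x xs) ?scale0r //.
- exact: undup_uniq.
- move=> y; rewrite mem_undup => /mapP[t]; rewrite mem_filter => /andP[/eqP <- tl] ->.
  exact: hl.
- by rewrite -(group V id).
Qed.

Lemma basis_representation v : exists l,
  [/\ \sum_(t <- l) t.1 *: t.2 = v, forall t, t \in l -> exists q, B q t.2
    & forall q, gpart q v -> forall t, t \in l -> gpart q t.2].
Proof.
have part q x : gpart q x -> exists l, \sum_(t <- l) t.1 *: t.2 = x /\
    forall t, t \in l -> B q t.2.
  move=> hx; have [_ /(_ x hx)[s [c [hs ->]]] _] := basisB q.
  exists [seq (c y, y) | y <- s]; rewrite big_map; split=> // t /mapP[y ys ->].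
  exact: hs.
have [->|v0] := eqVneq v 0; first by exists [::]; rewrite big_nil; split.
have [[q hq]|nohom] := pselect (exists q, gpart q v).
  have [l [el hl]] := part q v hq; exists l; split=> // [t tl|r hr t tl].
    by exists q; apply: hl.
  have [->|nqr] := eqVneq r q; last by rewrite (gpart_inter hr hq nqr) eqxx in v0.
  by have [sub _ _] := basisB q; apply/sub/hl.
suff [l [el hl]] : exists l, \sum_(t <- l) t.1 *: t.2 = v /\
    forall t, t \in l -> exists q, B q t.2.
  by exists l; split=> // q hq; case: nohom; exists q.
have [[n c] /= [hc ->]] := gpart_span v; elim: n => [|n [l [el hl]]].
  by exists [::]; rewrite big_nil big_ord0.
have [l' [el' hl']] := part n (c n) (hc n).
exists (l ++ l'); rewrite big_cat big_ord_recr /= el el'; split=> // t.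
by rewrite mem_cat => /orP[/hl|/hl' ht] //; exists n.
Qed.

Lemma graded_dual_basis_exists : exists rep, graded_dual_basis rep.
Proof.
have [rep hrep] := choice basis_representation.
exists rep; split=> [v|q v hq t tl|W phi c x y].
- by have [] := hrep v.
- by have [_ _ h] := hrep v; apply: h tl.
have [ex hx _] := hrep x; have [ey hy _] := hrep y.
have [exy hxy _] := hrep (c *: x + y).
pose l := rep (c *: x + y) ++ [seq (- (c * t.1), t.2) | t <- rep x]
  ++ [seq (- t.1, t.2) | t <- rep y].
have suml (U : lmodType L) (psi : V -> U) : \sum_(t <- l) t.1 *: psi t.2 =
    \sum_(t <- rep (c *: x + y)) t.1 *: psi t.2
    - (c *: (\sum_(t <- rep x) t.1 *: psi t.2) + \sum_(t <- rep y) t.1 *: psi t.2).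
  rewrite !big_cat /= !big_map /= opprD scaler_sumr -!sumrN; congr (_ + (_ + _)).
    by apply: eq_bigr => t _; rewrite scaleNr scalerA.
  by apply: eq_bigr => t _; rewrite scaleNr.
apply/eqP; rewrite -subr_eq0 -suml; apply/eqP; apply: basis_relation.
  move=> t; rewrite !mem_cat => /or3P[/hxy|/mapP[u ut ->]|/mapP[u ut ->]] //=.
    exact: hx.
  exact: hy.
by rewrite (suml V id) exy ex ey subrr.
Qed.

End GradedFree.

Section HomologyClass.
Variables (L : comPzRingType) (D : dgmod L).
Implicit Types (x y : D).

(* Zero when [x] is not a cycle. *)
Definition class_of x : homology D := if insub x is Some z then hclass z else 0.

Lemma class_ofE (z : Defs.cycle D) : class_of (z : D) = hclass z.
Proof. by rewrite /class_of valK. Qed.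

Lemma cycleE x : diff x = 0 -> exists z : Defs.cycle D, z = x :> D.
Proof. by move=> /eqP dx; exists (@Cycle L D x dx). Qed.

Lemma class_ofP c x y : diff x = 0 -> diff y = 0 ->
  class_of (c *: x + y) = c *: class_of x + class_of y.
Proof.
move=> /cycleE[z <-] /cycleE[w <-].
by rewrite !class_ofE -hclass_linear -class_ofE.
Qed.

Lemma class_of_diff x : class_of (diff x) = 0.
Proof.
have [z ez] := cycleE (diffK x).
by rewrite -ez class_ofE; apply/hclass0P; exists x.
Qed.

Lemma class_of0 : class_of 0 = 0.
Proof. by rewrite -(lin0 (@diff_linear _ D)) class_of_diff. Qed.

Lemma class_ofN x : diff x = 0 -> class_of (- x) = - class_of x.
Proof.
move=> dx; have := class_ofP (-1) dx (lin0 (@diff_linear _ D)).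
by rewrite class_of0 !addr0 !scaleN1r.
Qed.

Lemma class_of_eq0 x : diff x = 0 -> class_of x = 0 -> exists y, diff y = x.
Proof. by move=> /cycleE[z <-]; rewrite class_ofE => /hclass0P. Qed.

Lemma gpart_class_of (q : nat) x : diff x = 0 -> gpart q x -> gpart q (class_of x).
Proof. by move=> /cycleE[z <-] hz; rewrite class_ofE; exists z. Qed.

Lemma induces_idP (g : homology D -> D) :
  induces_id g <-> (forall h, diff (g h) = 0 /\ class_of (g h) = h).
Proof.
split=> h k; first by have [z <- <-] := h k; rewrite class_ofE diff_cycle.
have [/cycleE[z ez] e] := h k; exists z => //.
by rewrite -class_ofE ez.
Qed.

Lemma homogeneous_preimage (q : nat) y : gpart q (diff y) ->
  exists2 y', gpart q.+1 y' & diff y' = diff y.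
Proof.
have [[m d] /= [hd ->]] := gpart_span y => hq.
pose d' r := if (r < m)%N then d r else 0.
have hd' r : gpart r (d' r) by rewrite /d'; case: ifP => // _; apply: gpart0.
exists (d' q.+1); first exact: hd'.
pose E (r : nat) (x : D) := if r == q then x else 0.
have E0 r : E r 0 = 0 by rewrite /E; case: ifP.
have es : \sum_(r < m.+1) diff (d' r.+1) = diff (\sum_(r < m) d r).
  rewrite linear_sum /=; case: m @d' hd' {hq} => [|m] d' hd'.
    by rewrite big_ord1 /d' big_ord0 (lin0 (@diff_linear _ D)).
  have d0 r : (m < r)%N -> d' r = 0 by move=> ltr; rewrite /d' ltnNge ltr.
  rewrite big_ord_recr /= big_ord_recr /= !d0 //.
  rewrite !(lin0 (@diff_linear _ D)) !addr0 [RHS]big_ord_recl.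
  rewrite (diff_gpart0 (hd _)) add0r.
  by apply: eq_bigr => r _; rewrite /d' ltnS ltn_ord.
pose c r := if r == q then diff (\sum_(r < m) d r) else 0.
have hc r : gpart r (c r) by rewrite /c; case: eqP => [->|_] //; apply: gpart0.
have ec (F : nat -> D -> D) : (forall r, F r 0 = 0) ->
    \sum_(r < q.+1) F r (c r) = F q (diff (\sum_(r < m) d r)).
  move=> F0; rewrite big_ord_recr /= big1 ?add0r /c ?eqxx // => i _.
  by rewrite ltn_eqF.
have es' := etrans es (esym (ec (fun _ => id) (fun _ => erefl))).
have := decomposition_uniq (fun r => diff_gpartS (hd' r.+1)) hc E0 es'.
rewrite (ec E E0) /E eqxx => <-.
rewrite -big_mkcond /= (big_ord1_eq _ (fun r => diff (d' r.+1))).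
case: ifP => // /negbT; rewrite -leqNgt => ltq.
have nq : (q.+1 < m)%N = false by lia.
by rewrite /d' nq (lin0 (@diff_linear _ D)).
Qed.

Lemma diff_section : exists pre : D -> D,
  [/\ pre 0 = 0, forall y, diff (pre (diff y)) = diff y
    & forall q y, gpart q (diff y) -> gpart q.+1 (pre (diff y))].
Proof.
have /choice[pre hpre] x : exists z, (x = 0 -> z = 0) /\
    ((exists y, diff y = x) -> diff z = x /\
      (forall q, gpart q x -> gpart q.+1 z)).
  have [->|x0] := eqVneq x 0.
    exists 0; split=> // _; split=> [|q _]; last exact: gpart0.
    exact: lin0 (@diff_linear _ D).
  have [[q hq]|nohom] := pselect (exists q, gpart q x); last first.
    have [[y ey]|nex] := pselect (exists y, diff y = x).
      exists y; split=> [x0'|_]; first by rewrite x0' eqxx in x0.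
      by split=> // q hq; case: nohom; exists q.
    by exists 0; split=> // ex; case: nex.
  have [[y ey]|nex] := pselect (exists y, diff y = x); last first.
    by exists 0; split=> // ex; case: nex.
  rewrite -ey in hq; have [y' hy' ey'] := homogeneous_preimage hq.
  exists y'; split=> [x0'|_]; first by rewrite x0' eqxx in x0.
  split=> [|r hr]; first by rewrite ey'.
  have [->|nqr] := eqVneq r q => //.
  by rewrite -ey in hr x0; rewrite (gpart_inter hr hq nqr) eqxx in x0.
exists pre; split=> [|y|q y hq]; first exact: (hpre 0).1.
  by have [|-> _] := (hpre (diff y)).2 => //; exists y.
by have [|_] := (hpre (diff y)).2; [exists y | apply].
Qed.

Lemma class_section : exists zz : homology D -> D,
  forall h, [/\ diff (zz h) = 0, class_of (zz h) = h
    & forall q, gpart q h -> gpart q (zz h)].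
Proof.
suff /choice[zz hzz] h : exists z, [/\ diff z = 0, class_of z = h
    & forall q, gpart q h -> gpart q z] by exists zz.
have [->|h0] := eqVneq h 0.
  exists 0; split=> [||q _]; last exact: gpart0.
    exact: lin0 (@diff_linear _ D).
  exact: class_of0.
have [[q hq]|nohom] := pselect (exists q, gpart q h).
  have [z hz ez] := hq; exists (z : D); split=> [||r hr].
  - exact: diff_cycle.
  - by rewrite class_ofE.
  have [->|nqr] := eqVneq r q => //.
  by rewrite (gpart_inter hr hq nqr) eqxx in h0.
exists (repr h : D); split=> [||q hq]; first exact: diff_cycle.
  by rewrite class_ofE hclass_repr.
by case: nohom; exists q.
Qed.

End HomologyClass.

Section MultilinearExtension.
Variables (L : comPzRingType) (M P : gmod L) (W : gmod L).
Variables (repM : M -> seq (L * M)) (repP : P -> seq (L * P)).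
Hypotheses (dbM : graded_dual_basis repM) (dbP : graded_dual_basis repP).
Implicit Types (G : seq M -> P -> W) (a : seq M) (b : P).

Fixpoint extend G a b : W :=
  if a is x :: a' then
    \sum_(t <- repM x) t.1 *: extend (fun l => G (t.2 :: l)) a' b
  else \sum_(t <- repP b) t.1 *: G [::] t.2.

Lemma extend_multilinear G : multilinear2 (extend G).
Proof.
have [_ _ linM] := dbM; have [_ _ linP] := dbP.
split=> [b s1 s2|a].
  elim: s1 G => [|y s1 IH] G /=.
    exact: (linM W (fun t => extend (fun l => G (t :: l)) s2 b)).
  move=> c x z; rewrite scaler_sumr -big_split; apply: eq_bigr => t _ /=.
  by rewrite (IH (fun l => G (t.2 :: l)) c x z) scalerDr !scalerA mulrC.
elim: a G => [|y a IH] G /=; first exact: (linP W (G [::])).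
move=> c x z; rewrite scaler_sumr -big_split; apply: eq_bigr => t _ /=.
by rewrite (IH (fun l => G (t.2 :: l)) c x z) scalerDr !scalerA mulrC.
Qed.

Lemma extend_id G a b : multilinear2 G -> extend G a b = G a b.
Proof.
have [sumM _ _] := dbM; have [sumP _ _] := dbP.
elim: a G => [|x a IH] G mG /=.
  rewrite -{2}(sumP b); elim: (repP b) => [|t l IHl].
    by rewrite !big_nil (lin0 (mG.2 [::])).
  by rewrite !big_cons (mG.2 [::]) IHl.
rewrite -{2}(sumM x); elim: (repM x) => [|t l IHl].
  by rewrite !big_nil (lin0 (mG.1 b [::] a)).
rewrite !big_cons (mG.1 b [::] a) IHl /= IH //.
exact: multilinear2_cons.
Qed.

Lemma extend_linear (h : W -> W) G a b : linear h ->
  h (extend G a b) = extend (fun l c => h (G l c)) a b.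
Proof.
move=> lin; elim: a G => [|x a IH] G /=.
  by elim/big_rec2: _ => [|t y z _ <-]; rewrite ?(lin0 lin) // lin.
elim/big_rec2: _ => [|t y z _ <-]; first exact: lin0.
by rewrite lin IH.
Qed.

Lemma eq_extend G1 G2 a b :
  (forall l c, size l = size a -> G1 l c = G2 l c) -> extend G1 a b = extend G2 a b.
Proof.
elim: a G1 G2 => [|x a IH] G1 G2 e /=.
  by apply: eq_bigr => t _; rewrite e.
apply: eq_bigr => t _; congr (_ *: _); apply: IH => l c sl.
by apply: e; rewrite /= sl.
Qed.

Lemma extend_gpartz G q r a b z : homogeneous q a -> gpart r b ->
  (forall a' b', size a' = size a -> homogeneous q a' -> gpart r b' ->
     gpartz z (G a' b')) ->
  gpartz z (extend G a b).
Proof.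
have [_ homM _] := dbM; have [_ homP _] := dbP.
move=> ha hb; elim: ha G => [|n x {}q {}a hx ha IH] G hG /=.
  rewrite big_seq; elim/big_rec: _ => [|t y /(homP _ _ hb) ht hy].
    exact: gpartz0.
  by apply: gpartzD hy; apply: gpartzZ; apply: hG => //; apply: List.Forall2_nil.
rewrite big_seq; elim/big_rec: _ => [|t y /(homM _ _ hx) ht hy].
  exact: gpartz0.
apply: gpartzD hy; apply: gpartzZ; apply: IH => a' b' sa ha' hb'.
by apply: hG => //=; [rewrite sa | apply: List.Forall2_cons].
Qed.

End MultilinearExtension.

(** * The relations in terms of splittings *)

Section Compositions.
Variable W : nmodType.

Lemma compositions1 (i : nat) (F : seq nat -> W) : (0 < i)%N ->
  \sum_(ks in @compositions 1 i) F [seq val k | k <- ks] = F [:: i].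
Proof.
move=> i0; rewrite (big_pred1 [tuple ord_max]) // => ks; rewrite inE.
case/tupleP: ks => k ks; rewrite [ks]tuple0 /= andbT addn0 -val_eqE /= eqseq_cons andbT.
by rewrite -val_eqE /=; case: eqP => [->|]; rewrite ?i0 ?andbF.
Qed.

Lemma compositions2 (i : nat) (F : seq nat -> W) :
  \sum_(ks in @compositions 2 i) F [seq val k | k <- ks]
  = \sum_(1 <= k < i) F [:: k; i - k]%N.
Proof.
rewrite (reindex_onto (fun k : 'I_i.+1 => [tuple k; inord (i - k)])
  (fun ks => tnth ks ord0)) /=; last first.
  move=> ks; case/tupleP: ks => k ks; case/tupleP: ks => k' ks.
  rewrite [ks]tuple0 inE /= addn0 => /andP[_ /eqP e].
  apply/val_inj => /=; congr [:: _; _].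
  rewrite (tnth_nth k) /=; have -> : (i - k = k')%N by move: e; lia.
  by rewrite inord_val.
rewrite (big_nat_widen 1 i i.+1) // big_geq_mkord.
apply: eq_big => [k|k _]; last first.
  by rewrite /= inordK // ltnS leq_subr.
rewrite inE (tnth_nth k) /= eqxx andbT addn0 inordK ?ltnS ?leq_subr //.
have := ltn_ord k; lia.
Qed.

End Compositions.

Section UnfoldedRelations.
Variable L : comPzRingType.

Lemma insert_sumE (M : gmod L) (W : lmodType L) (h : seq M -> W) (m : seq M -> M) a :
  multilinear h -> insert_sum h m a = ins m h a.
Proof.
move=> mh; rewrite /ins splitsE big_nat_recr //= drop_size addr0.
apply: eq_big_nat => k /andP[_ ltk]; rewrite splits1E size_drop.
apply: eq_big_nat => j _; rewrite drop_drop map_shat multilinear_scale_all //.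
by rewrite size_map size_takel 1?ltnW // addnC.
Qed.

Lemma insert_last_sumE (M P : gmod L) (W : lmodType L) (g : seq M -> P -> W)
    (p : seq M -> P -> P) a b :
  multilinear2 g ->
  insert_last_sum g p a b = splits a (fun u v => g (map (@shat L M) u) (p v b)).
Proof.
move=> [mg _]; rewrite splitsE; apply: eq_big_nat => k /andP[_ ltk].
rewrite map_shat -[map _ (map _ (take k a))]cats0.
rewrite (multilinear_scale_all (m := g^~ (p (drop k a) b))) // cats0.
by rewrite size_map size_takel.
Qed.

Lemma insert_sums_dom (M P : gmod L) (W : lmodType L) (X : seq M -> M)
    (p : seq M -> P -> P) (g : seq M -> P -> W) a b :
  multilinear2 g -> insert_sum (g^~ b) X a + insert_last_sum g p a b = dom X p g a b.
Proof. by move=> mg; rewrite insert_last_sumE // (insert_sumE _ _ (mg.1 b)). Qed.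

Lemma split_sum_dga (C : dgalg L) (M : gmod L) (f : seq M -> C) a : (0 < size a)%N ->
  split_sum f (@dga_ainf L C) a = diff (f a)
    + \sum_(1 <= k < size a) dga_mul (shat (f (take k a))) (f (drop k a)).
Proof.
move=> a0; pose T t := \sum_(ks in @compositions t (size a))
    dga_ainf [seq f s | s <- reshape [seq val k | k <- ks] a].
have T1 : T 1%N = diff (f a).
  rewrite /T (compositions1 (fun ks => dga_ainf [seq f s | s <- reshape ks a])) //.
  by rewrite /= take_size.
have T2 : T 2%N = \sum_(1 <= k < size a) dga_mul (shat (f (take k a))) (f (drop k a)).
  rewrite /T (compositions2 _ (fun ks => dga_ainf [seq f s | s <- reshape ks a])).
  apply: eq_big_nat => k _ /=.
  rewrite [take (size a - k) _]take_oversize ?size_drop // /shat.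
  by rewrite (linN (pairing_linearl (dga_pairing C) _)).
have T3 t : T t.+3 = 0.
  rewrite /T big1 // => ks _.
  have : size [seq f s | s <- reshape [seq val k | k <- ks] a] = t.+3.
    by rewrite size_map size_reshape size_map size_tuple.
  by case: map => [|x [|y [|z l]]].
rewrite /split_sum -/(T _) (eq_bigr T) // big_ltn ?ltnS // T1; congr (_ + _).
case: (ltnP 1 (size a)) => [a1|a1]; last by rewrite !big_geq.
rewrite big_ltn // T2 [X in _ + X]big_nat [X in _ + X]big1 ?addr0 // => -[|[|[|t]]] // _.
Qed.

Lemma split_last_sum_dgm (C : dgalg L) (D : dgamod C) (M P : gmod L)
    (f : seq M -> C) (g : seq M -> P -> D) a b :
  split_last_sum f g (@dgm_ainf L C D) a b = diff (g a b)
    + splits1 a (fun u v => dgm_act (shat (f u)) (g v b)).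
Proof.
pose F t ks := let blocks := reshape ks a in
  dgm_ainf [seq f s | s <- take t.-1 blocks] (g (nth [::] blocks t.-1) b).
pose T t := \sum_(ks in @compositions t (size a).+1) F t [seq val k | k <- ks].
have T1 : T 1%N = diff (g a b).
  by rewrite /T (compositions1 (F 1%N)) // /F /= take_oversize.
have T2 : T 2%N = splits1 a (fun u v => dgm_act (shat (f u)) (g v b)).
  rewrite /T (compositions2 _ (F 2)) splits1E; apply: eq_big_nat => k /andP[_ ltk].
  rewrite /F /= [take (_ - k) _]take_oversize ?size_drop ?leq_sub2r //.
  by rewrite /shat (linN (pairing_linearl (dgm_pairing D) _)).
have T3 t : T t.+3 = 0.
  rewrite /T big1 // => ks _; rewrite /F /=.
  have : size (reshape [seq val k | k <- ks] a) = t.+3.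
    by rewrite size_reshape size_map size_tuple.
  by case: reshape => [|x [|y l]].
rewrite /split_last_sum -/(T _) (eq_bigr T) // big_ltn ?ltnS // T1; congr (_ + _).
have [s0|s0] := posnP (size a); first by rewrite big_geq ?s0 // (size0nil s0).
rewrite big_ltn // T2 [X in _ + X]big_nat [X in _ + X]big1 ?addr0 // => -[|[|[|t]]] // _.
Qed.

End UnfoldedRelations.

(** * The inductive construction *)

Section Construction.
Variables (L : comPzRingType) (C : dgalg L) (D : dgamod C).
Variables (X : seq (homology C) -> homology C) (f : seq (homology C) -> C).
Hypotheses (mX : multilinear X) (dX : has_degree (-2) X).
Hypothesis relX : forall a, (0 < size a)%N -> ins X X a = 0.
Hypothesis X1 : forall x, X [:: x] = 0.
Hypotheses (mf : multilinear f) (df : has_degree (-1) f) (f0 : f [::] = 0).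
Hypothesis relf : forall a, (0 < size a)%N ->
  ins X f a = diff (f a) + splits a (fun u v => dga_mul (shat (f u)) (f v)).
Variables (repC : homology C -> seq (L * homology C))
  (repD : homology D -> seq (L * homology D)).
Hypotheses (dbC : graded_dual_basis repC) (dbD : graded_dual_basis repD).

Notation actions := (seq (homology C) -> homology D -> homology D).
Notation cochains := (seq (homology C) -> homology D -> D).
Implicit Types (Y : actions) (g : cochains).

Definition partial_morphism (n : nat) Y g : Prop :=
  [/\ [/\ multilinear2 Y, has_degree2 (-2) Y & forall b, Y [::] b = 0],
      [/\ multilinear2 g, has_degree2 (-1) g & induces_id (g [::])],
      forall a b, (size a < n)%N -> defect X Y f g a b = 0
    & forall a b, (size a < n)%N -> dom X Y Y a b = 0].

Lemma dom_zero (P W : lmodType L) (p : seq (homology C) -> P -> P) a b :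
  dom X p (fun _ _ => 0 : W) a b = 0.
Proof.
rewrite /dom /ins !splits_eq0 ?addr0 // => u v _.
exact: splits1_eq0.
Qed.

Lemma gpartz_class_of (z : int) (x : D) :
  diff x = 0 -> gpartz z x -> gpartz z (class_of x).
Proof.
case: z => [q|q] dx; first exact: gpart_class_of.
move/gpartz_neg->; rewrite class_of0; apply: gpartz0.
Qed.

Lemma obstruction_cycle n Y g : (0 < n)%N -> partial_morphism n Y g ->
  forall a b, size a = n -> diff (defect X Y f g a b) = 0 /\ dom X Y Y a b = 0.
Proof.
move=> n0 [[mY dY Y0] [mg dg /induces_idP g1] def0 rel0] a b sa.
have a0 : (0 < size a)%N by rewrite sa.
have mU := multilinear2_defect mX mf mY mg.
have domU : dom X Y (defect X Y f g) a b = 0.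
  have /= := @dom_local_lt _ _ _ _ X1 D Y Y (defect X Y f g) (fun _ _ => 0) a b mU.
  rewrite dom_zero def0 ?subrr ?subr0 //; apply=> //.
    by split=> [c|s]; [move=> s1 s2|]; apply: linear_zero_fun.
  by move=> l sl; apply/funext => c; rewrite def0 // -sa.
have := defect_identity Y mX dX relX mf df f0 relf a b mg.
rewrite domU addr0.
have -> : splits a (fun u v => dgm_act (f u) (defect X Y f g v b)) = 0.
  apply: splits_eq0 => -[|x u] v ea.
    by rewrite f0 (lin0 (pairing_linearl (dgm_pairing D) _)).
  rewrite def0; first exact: lin0 (pairing_linearr (dgm_pairing D) _).
  by rewrite -sa ea /= size_cat; lia.
rewrite addr0.
have -> : splits a (fun u v => g u (dom X Y Y v b)) = g [::] (dom X Y Y a b).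
  case: a sa a0 {domU} => // x a sa _ /=; rewrite splits_eq0 ?addr0 // => u v ea.
  by rewrite rel0 ?(lin0 (mg.2 _)) // -sa ea /= size_cat; lia.
move=> e.
have A0 : dom X Y Y a b = 0.
  by rewrite -[LHS](g1 _).2 -e class_of_diff.
by split=> //; rewrite e A0 (lin0 (mg.2 _)).
Qed.

Lemma extend_partial_morphism n Y g : (0 < n)%N -> partial_morphism n Y g ->
  exists Yg : actions * cochains, partial_morphism n.+1 Yg.1 Yg.2 /\
    forall l, (size l < n)%N -> Yg.1 l = Y l /\ Yg.2 l = g l.
Proof.
move=> n0 pYg; have obs := obstruction_cycle n0 pYg.
have [[mY dY Y0] [mg dg ig] def0 rel0] := pYg; have g1 := (induces_idP _).1 ig.
have [pre [pre0 preK pre_deg]] := diff_section D.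
pose U := defect X Y f g.
have mU : multilinear2 U by exact: multilinear2_defect.
have dU : has_degree2 (-2) U by exact: has_degree2_defect.
have cycU a b : size a = n -> diff (U a b) = 0 by move=> sa; have [] := obs a b sa.
pose dltY : actions := fun a b => if size a == n then - class_of (U a b) else 0.
have mdltY : multilinear2 dltY.
  split=> [b s1 s2|s] c x y; rewrite /dltY ?size_cat /=; case: eqP => sn;
    rewrite ?scaler0 ?addr0 //.
    rewrite (mU.1 b s1 s2) class_ofP ?opprD ?scalerN //.
      by apply: cycU; rewrite size_cat.
    by apply: cycU; rewrite size_cat.
  rewrite (mU.2 s) class_ofP ?opprD ?scalerN //.
    exact: cycU.
  exact: cycU.
have ddltY : has_degree2 (-2) dltY.
  move=> q r a b ha hb; rewrite /dltY; case: eqP => sa; last exact: gpartz0.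
  apply: gpartzN; apply: gpartz_class_of (dU _ _ _ _ ha hb).
  exact: cycU.
pose V : cochains := fun a b => if size a == n then U a b + g [::] (dltY a b) else 0.
have mUg := multilinear2D mU (multilinear2_comp (mg.2 [::]) mdltY).
have mV : multilinear2 V.
  split=> [b s1 s2|s] c x y; rewrite /V ?size_cat /=; case: eqP => sn;
    rewrite ?scaler0 ?addr0 //.
    exact: (mUg.1 b s1 s2).
  exact: (mUg.2 s).
have bV a b : exists y, diff y = V a b.
  rewrite /V; case: eqP => sa; last by exists 0; apply: lin0 (@diff_linear _ D).
  have dUab := cycU a b sa; have [dgab clg] := g1 (dltY a b).
  apply: class_of_eq0; first by rewrite (linD (@diff_linear _ D)) dUab dgab addr0.
  by rewrite -[U a b]scale1r class_ofP // clg scale1r /dltY sa eqxx subrr.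
have hV q r a b : homogeneous q a -> gpart r b ->
    gpartz ((sumn q + r)%N%:Z + (size a).+1%:Z - 2) (V a b).
  move=> ha hb; rewrite /V; case: eqP => sa; last exact: gpartz0.
  apply: gpartzD; first exact: dU.
  have := has_degree2_gpartz mg dg (List.Forall2_nil _) (ddltY _ _ _ _ ha hb).
  by congr gpartz => /=; lia.
pose dltg : cochains := extend repC repD (fun a b => pre (V a b)).
have mdltg : multilinear2 dltg by exact: extend_multilinear.
have diff_dltg a b : diff (dltg a b) = V a b.
  rewrite (extend_linear _ _ _ _ _ (@diff_linear _ D)) -[RHS](extend_id dbC dbD) //.
  by apply: eq_extend => l c _; have [y <-] := bV l c.
have dltg0 a b : size a != n -> dltg a b = 0.
  move=> sa; rewrite -[RHS](extend_id dbC dbD (G := fun _ _ => 0) a b); last first.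
    by split=> [c|s]; [move=> s1 s2|]; apply: linear_zero_fun.
  by apply: eq_extend => l c sl; rewrite /V sl (negbTE sa).
have ddltg : has_degree2 (-1) dltg.
  move=> q r a b ha hb; have [sa|sa] := eqVneq (size a) n; last first.
    by rewrite dltg0 //; apply: gpartz0.
  apply: (extend_gpartz dbC dbD ha hb) => a' b' sa' ha' hb'.
  have [y ey] := bV a' b'; have := hV _ _ _ _ ha' hb'; rewrite -ey sa'.
  have -> : (sumn q + r)%N%:Z + (size a).+1%:Z - 2 = (sumn q + r + n.-1)%N by lia.
  move/pre_deg.
  by have -> : (sumn q + r)%N%:Z + (size a).+1%:Z - 1 = (sumn q + r + n.-1).+1 by lia.
pose Y' : actions := fun a b => Y a b + dltY a b.
pose g' : cochains := fun a b => g a b + dltg a b.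
have mY' : multilinear2 Y' by exact: multilinear2D.
have mg' : multilinear2 g' by exact: multilinear2D.
have eY l : (size l < n)%N -> Y' l = Y l.
  by move=> sl; apply/funext => b; rewrite /Y' /dltY ltn_eqF // addr0.
have eg l : (size l < n)%N -> g' l = g l.
  by move=> sl; apply/funext => b; rewrite /g' dltg0 ?addr0 // ltn_eqF.
have Y'0 b : Y' [::] b = 0 by rewrite eY.
exists (Y', g'); split=> [|l sl] /=; last by rewrite eY ?eg.
split; [split=> // | split=> // | |].
- by move=> q r a b ha hb; apply: gpartzD; [apply: dY | apply: ddltY].
- by move=> q r a b ha hb; apply: gpartzD; [apply: dg | apply: ddltg].
- by rewrite eg.
- move=> a b; rewrite ltnS leq_eqVlt => /orP[/eqP sa|sa]; last first.
    rewrite -(def0 a b sa); apply: defect_local => l sl; [apply: eg|apply: eY];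
    exact: leq_ltn_trans sl sa.
  have := @defect_local_lt _ _ D _ _ _ f X1 f0 Y' Y g' g a b mg' mg Y'0 Y0.
  rewrite sa => /(_ n0 eg eY).
  rewrite eg // (linD (mg.2 _)) (linD (@diff_linear _ D)) diff_dltg /V sa eqxx.
  rewrite -/(U a b).
  move: (defect _ _ _ _ a b) (U a b) (g [::] (Y a b)) (g [::] (dltY a b)) (diff (g a b)).
  move=> d' u gY gd dg' /(congr1 (fun t => t - u + gY - dg')).
  rewrite opprD [LHS](AC ((1*2)*(1*2)*1*1*1) (1*((2*8)*(3*6)*(4*9)*(5*7)))) /=.
  rewrite [RHS](AC 6 ((1*4)*(2*5)*(3*6))) /=.
  by rewrite !addNr !subrr !addr0.
move=> a b; rewrite ltnS leq_eqVlt => /orP[/eqP sa|sa]; last first.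
  by rewrite -(rel0 a b sa); apply: dom_local => l sl; apply: eY;
    apply: leq_ltn_trans sl sa.
have := @dom_local_lt _ _ _ X X1 _ Y' Y Y' Y a b mY' mY Y'0 Y0.
rewrite sa => /(_ n0 eY eY); rewrite Y'0 Y0 !subr0 => ->.
by have [] := obs a b sa.
Qed.

Lemma partial_morphism1 : exists Yg : actions * cochains, partial_morphism 1 Yg.1 Yg.2.
Proof.
have [zz hzz] := class_section D; have [sumD homD linD'] := dbD.
pose g0 (b : homology D) : D := \sum_(t <- repD b) t.1 *: zz t.2.
have g0E b : diff (g0 b) = 0 /\ class_of (g0 b) = b.
  rewrite -{3}(sumD b) /g0; elim: (repD b) => [|t l [dl cl]].
    rewrite !big_nil; split; first exact: lin0 (@diff_linear _ D).
    exact: class_of0.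
  have [dz cz _] := hzz t.2; rewrite !big_cons; split.
    by rewrite (@diff_linear _ D) dz dl scaler0 addr0.
  by rewrite class_ofP // cz cl.
have mY : multilinear2 ((fun _ _ => 0) : actions).
  by split=> [c|s]; [move=> s1 s2|]; apply: linear_zero_fun.
exists (fun _ _ => 0, fun a b => if a is [::] then g0 b else 0); split=> /=.
- by split=> // q r a b _ _; apply: gpartz0.
- split; last exact/induces_idP.
    split=> [b s1 s2|[|x s]]; last exact: linear_zero_fun.
      by case: s1 => [|y s1]; apply: linear_zero_fun.
    exact: (linD' D zz).
  move=> q r a b ha hb; case: ha => [|n x {}q {}a _ _]; last exact: gpartz0.
  have -> : (sumn [::] + r)%N%:Z + (size ([::] : seq (homology C))).+1%:Z - 1 = r%:Z.
    by rewrite /=; lia.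
  rewrite /= /g0 big_seq; elim/big_rec: _ => [|t y /(homD _ _ hb) ht hy].
    exact: gpart0.
  by have [_ _ hz] := hzz t.2; apply: gpartP => //; apply: hz.
- case=> // b _; have [dg0 _] := g0E b; have [dg00 cg00] := g0E 0.
  rewrite /defect dom_nil /= dg0 add0r f0 (lin0 (@shat_linear _ C)).
  rewrite (lin0 (pairing_linearl (dgm_pairing D) _)) subr0.
  exact: (lin0 (linD' D zz)).
- by move=> a b _; apply: dom_zero.
Qed.

Lemma morphism_exists : exists Yg : actions * cochains,
  forall n, partial_morphism n Yg.1 Yg.2.
Proof.
pose state n := {Yg : actions * cochains | partial_morphism n.+1 Yg.1 Yg.2}.
pose step n (st : state n) := cid (extend_partial_morphism (ltn0Sn n) (svalP st)).
pose next n (st : state n) : state n.+1 := exist _ (sval (step n st)) (svalP (step n st)).1.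
pose st := nat_rect state (exist _ _ (svalP (cid partial_morphism1))) next.
have stE m n l : (size l <= n)%N ->
    (sval (st (n + m)%N)).1 l = (sval (st n)).1 l /\
    (sval (st (n + m)%N)).2 l = (sval (st n)).2 l.
  move=> sl; elim: m => [|m [IH1 IH2]]; first by rewrite addn0.
  have sl' : (size l < (n + m).+1)%N by lia.
  rewrite addnS -IH1 -IH2.
  exact: (svalP (step _ (st (n + m)%N))).2 l sl'.
pose Y : actions := fun a => (sval (st (size a))).1 a.
pose g : cochains := fun a => (sval (st (size a))).2 a.
have YE n l : (size l <= n)%N -> Y l = (sval (st n)).1 l.
  by move=> sl; rewrite -(subnKC sl) (stE _ _ _ (leqnn _)).1.
have gE n l : (size l <= n)%N -> g l = (sval (st n)).2 l.
  by move=> sl; rewrite -(subnKC sl) (stE _ _ _ (leqnn _)).2.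
exists (Y, g) => n; rewrite /=.
split; [split | split | |].
- split=> [b s1 s2 c x y|a]; last by have [[[_ m] _ _] _ _ _] := svalP (st (size a)); apply: m.
  rewrite /Y !size_cat /=; have [[[m _] _ _] _ _ _] := svalP (st (size s1 + (size s2).+1)%N).
  exact: m.
- move=> q r a b ha hb; have [[_ d _] _ _ _] := svalP (st (size a)).
  exact: d.
- by move=> b; have [[_ _ d] _ _ _] := svalP (st 0%N); apply: d.
- split=> [b s1 s2 c x y|a]; last by have [_ [[_ m] _ _] _ _] := svalP (st (size a)); apply: m.
  rewrite /g !size_cat /=; have [_ [[m _] _ _] _ _] := svalP (st (size s1 + (size s2).+1)%N).
  exact: m.
- move=> q r a b ha hb; have [_ [_ d _] _ _] := svalP (st (size a)).
  exact: d.
- by have [_ [_ _ d] _ _] := svalP (st 0%N).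
- move=> a b _; have [_ _ d _] := svalP (st (size a)).
  by rewrite -(d a b (ltnSn _)); apply: defect_local => l sl; [apply: gE|apply: YE].
move=> a b _; have [_ _ _ d] := svalP (st (size a)).
by rewrite -(d a b (ltnSn _)); apply: dom_local => l sl; apply: YE.
Qed.

Lemma partial_morphism_action Y g : partial_morphism 2 Y g ->
  induces_id (fun h => f [:: h]) -> forall a b, Y [:: a] b = - hact (hat a) b.
Proof.
move=> [[mY dY Y0] [mg dg ig] def0 _] if1 a b.
have [z ez cz] := if1 (hat a); have [w ew cw] := ig b.
have := def0 [:: a] b isT; rewrite /defect dom_cons dom_nil /= Y0.
rewrite X1 (lin0 (mg.1 b [::] [::])) (lin0 (mg.2 _)) add0r addr0.
rewrite (act_shat_f0 f0) add0r.
have -> : shat (f [:: a]) = - f [:: hat a].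
  rewrite -[in LHS](f_shat mf df f0 [:: a]) shatK /= /shat.
  exact: (linN (mf [::] [::])).
have := (induces_idP _).1 ig (Y [:: a] b).
rewrite -ez -ew => -[_ {2}<-].
move/eqP; rewrite subr_eq0 => /eqP ->.
have dzw : diff (dgm_act (z : C) (w : D)) = 0 by exact/eqP/(pairing_cycle (dgm_pairing D)).
rewrite (linN (pairing_linearl (dgm_pairing D) _)) -[diff _]scale1r.
rewrite class_ofP ?diffK ?diffN ?dzw ?oppr0 // class_of_diff scaler0 add0r class_ofN //.
by rewrite -cz -cw /hact hpairingE -class_ofE.
Qed.

End Construction.

Theorem theorem2 (L : comPzRingType) (C : dgalg L) (D : dgamod C)
    (X : seq (homology C) -> homology C) :
  (forall i : nat, is_free (gpart (g := homology C) i)) ->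
  (forall i : nat, is_free (gpart (g := homology D) i)) ->
  homology_ainf_algebra X ->
  exists Y : seq (homology C) -> homology D -> homology D,
    ainf_module X Y /\
    (forall b, Y [::] b = 0) /\
    (forall a b, Y [:: a] b = - hact (hat a) b) /\
    exists (f : seq (homology C) -> C) (g : seq (homology C) -> homology D -> D),
      Minf_morphism X Y (@dga_ainf L C) (@dgm_ainf L C D) f g /\
      induces_id (fun h => f [:: h]) /\
      induces_id (g [::]).
Proof.
move=> /choice[BC hBC] /choice[BD hBD] [[mX dX relX] X1 _ [f [[mf df relf] if1]]].
have [repC dbC] := graded_dual_basis_exists hBC.
have [repD dbD] := graded_dual_basis_exists hBD.
have insX a : (0 < size a)%N -> ins X X a = 0.
  by move=> a0; rewrite -insert_sumE // relX.
(* The value of [f] on the empty list is junk; it is normalized to zero. *)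
pose f0 a := if a is [::] then 0 else f a.
have f0E a : (0 < size a)%N -> f0 a = f a by case: a.
have mf0 : multilinear f0 by case=> [|x s1] s2; apply: mf.
have df0 : has_degree (-1) f0 by move=> q a a0; rewrite f0E //; apply: df.
have relf0 a : (0 < size a)%N ->
    ins X f0 a = diff (f0 a) + splits a (fun u v => dga_mul (shat (f0 u)) (f0 v)).
  move=> a0; rewrite (eq_ins _ _ f0E) -insert_sumE // relf // split_sum_dga // f0E //.
  congr (_ + _); rewrite splitsE big_nat_recr //= drop_size.
  rewrite (lin0 (pairing_linearr (dga_pairing C) _)) addr0 [in RHS]big_ltn // take0.
  rewrite (lin0 (@shat_linear _ _)) (lin0 (pairing_linearl (dga_pairing C) _)) add0r.
  apply: eq_big_nat => k /andP[k0 ltk].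
  by rewrite !f0E ?size_drop ?size_takel ?subn_gt0 // ltnW.
have [[Y g] /= hYg] := morphism_exists mX dX insX X1 mf0 df0 erefl relf0 dbC dbD.
have [[mY dY Y0] [mg dg ig] _ _] := hYg 0%N.
exists Y; split; [split=> // a b | split=> //; split].
- by rewrite insert_sums_dom //; have [_ _ _] := hYg (size a).+1; apply.
- exact: (partial_morphism_action X1 mf0 df0 erefl (hYg 2) if1).
exists f, g; split=> //; split=> // a b.
rewrite insert_sums_dom // split_last_sum_dgm.
have [_ _ /(_ a b (ltnSn _)) /eqP] := hYg (size a).+1.
rewrite subr_eq0 => /eqP -> _; rewrite splits_splits1 ?act_shat_f0 //.
Qed.
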